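(* Let $(\mathbf{u},p)\in\mathbf{V}\times W$ be the exact solution and $(\mathbf{u}_h,p_h)\in\mathbf{V}^*_h\times W_h$ the enhanced velocity mixed finite element solution of the model problem with $g=0$ (all defined in the context), and let $e_{\mathbf{u}}=\mathbf{u}-\mathbf{u}_h$. Assume the saturation assumption: there exist constants $\alpha<1$, $\beta<1$ and $h_f=h/m$ with $m\in\mathbb{N}$, $m\ge2$, such that the solution $(\mathbf{u}_{h_f},p_{h_f})\in\mathbf{V}^*_{h_f}\times W_{h_f}$ on the refined mesh satisfies $$\|\mathbf{u}-\mathbf{u}_{h_f}\|\le\beta\|\mathbf{u}-\mathbf{u}_h\|\qquad\text{and}\qquad\|p-p_{h_f}\|\le\alpha\|p-p_h\|.$$ Then there exists a constant $C$ independent of $h$ such that $$\|e_{\mathbf{u}}\|^2\le C\Big(\sum_{T\in\mathcal{T}_h}\Big\{\|\mathbf{K}^{-1}\mathbf{u}_h+\nabla p_h\|_T^2+\|f-\nabla\cdot\mathbf{u}_h\|_T^2\,h_T^2\Big\}+\sum_{e\in\mathcal{T}_h^\Gamma}\|[\![p_h]\!]\|_e^2\,h_e^{-1}\Big),$$ where $h_e$ is the diameter of $e$.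
   Context: Model problem. $\Omega\subset\mathbb{R}^d$, $d\in\{2,3\}$, is a multiblock domain, $f\in L^2(\Omega)$, and $\mathbf{K}$ is a symmetric uniformly positive definite tensor with $L^\infty(\Omega)$ components: $k_{min}\xi^T\xi\le\xi^T\mathbf{K}(x)\xi\le k_{max}\xi^T\xi$ for all $x\in\Omega$, $\xi\in\mathbb{R}^d$, with $0<k_{min}<k_{max}<\infty$. The problem is $\mathbf{u}=-\mathbf{K}\nabla p$, $\nabla\cdot\mathbf{u}=f$ in $\Omega$, $p=g=0$ on $\partial\Omega$. With $\mathbf{V}=H(\mathrm{div};\Omega)$ and $W=L^2(\Omega)$, $(\mathbf{u},p)\in\mathbf{V}\times W$ satisfies $(\mathbf{K}^{-1}\mathbf{u},\mathbf{v})-(p,\nabla\cdot\mathbf{v})=0$ for all $\mathbf{v}\in\mathbf{V}$ and $(\nabla\cdot\mathbf{u},w)=(f,w)$ for all $w\in W$. The problem is assumed $H^2$-regular: there is a constant depending only on $\mathbf{K},\Omega$ with $\|p\|_{H^2(\Omega)}\le C\|f\|$ (when $g=0$). $(\cdot,\cdot)$ and $\|\cdot\|$ are the $L^2(\Omega)$ inner product and norm; a subscript $T$ or $e$ means the $L^2$ norm on that set; $\nu$ is a unit normal. Meshes. $\Omega=(\bigcup_{i=1}^{n}\bar\Omega_i)^{o}$ is divided into subdomains $\Omega_i$, $\Gamma_{i,j}=\partial\Omega_i\cap\partial\Omega_j$ ($i\ne j$), $\Gamma=(\bigcup_{i,j}\bar\Gamma_{i,j})^{o}$, $\Gamma_i=\partial\Omega_i\setminus\partial\Omega$.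 $\mathcal{T}_{h,i}$ is a conforming, quasi-uniform, rectangular partition of $\Omega_i$ (rectangles/bricks aligned with the coordinate axes), $\mathcal{T}_h=\bigcup_i\mathcal{T}_{h,i}$ (possibly nonmatching on $\Gamma$), $h_T$ is the diameter of $T$, $h=\max_T h_T$, and mesh families are shape-regular. $\mathcal{T}_{h,i,j}$ is the intersection of the traces of $\mathcal{T}_{h,i}$ and $\mathcal{T}_{h,j}$ on $\Gamma_{i,j}$, and $\mathcal{T}_h^\Gamma=\bigcup_{i,j}\mathcal{T}_{h,i,j}$ is the resulting interface grid. $[\![p_h]\!]$ is the jump of $p_h$ across $e\in\mathcal{T}_h^\Gamma$. Discrete spaces. For a rectangle/brick $T$, $\mathbf{V}_h(T)$ is the lowest-order Raviart–Thomas space $\{\mathbf{v}:v_l=\alpha_l+\beta_lx_l,\ \alpha_l,\beta_l\in\mathbb{R},\ l=1,\dots,d\}$. $W_h$ is the space of functions constant on each $T\in\mathcal{T}_h$. $\mathbf{V}_{h,i}=\{\mathbf{v}\in H(\mathrm{div};\Omega_i):\mathbf{v}|_T\in\mathbf{V}_h(T)\ \forall T\in\mathcal{T}_{h,i}\}$, $\mathbf{V}_{h,i}^0=\{\mathbf{v}\in\mathbf{V}_{h,i}:\mathbf{v}\cdot\nu=0\text{ on }\Gamma_i\}$. For an element $T$ with a side on $\Gamma$, the interface grid partitions that side into pieces $e_k\in\mathcal{T}_h^\Gamma$; extending this partition into $T$ gives sub-elements $T_k$ (rectangles/bricks) with $e_k\subset\partial T_k$. Let $\mathbf{v}_{T_k}\in\mathbf{V}_h(T_k)$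 have normal component $1$ on $e_k$ and $0$ on all other sides of $T_k$ (extended by zero). $\mathbf{V}_h^\Gamma$ is the span of all such functions, and $\mathbf{V}_h^*=\big(\bigoplus_i\mathbf{V}^0_{h,i}\oplus\mathbf{V}_h^\Gamma\big)\cap H(\mathrm{div};\Omega)$. Discrete problem. $(\mathbf{u}_h,p_h)\in\mathbf{V}_h^*\times W_h$ satisfies $(\mathbf{K}^{-1}\mathbf{u}_h,\mathbf{v})=(p_h,\nabla\cdot\mathbf{v})$ for all $\mathbf{v}\in\mathbf{V}_h^*$ and $(\nabla\cdot\mathbf{u}_h,w)=(f,w)$ for all $w\in W_h$. On each element $T$, $\nabla p_h$ is the elementwise gradient. Refined problem. $\mathbf{V}^*_{h_f},W_{h_f}$ are the same finite element spaces built on a refinement of $\mathcal{T}_h$ with mesh size $h_f=h/m$, so that $\mathbf{V}^*_h\subset\mathbf{V}^*_{h_f}$ and $W_h\subset W_{h_f}$; $(\mathbf{u}_{h_f},p_{h_f})\in\mathbf{V}^*_{h_f}\times W_{h_f}$ is the solution of the discrete problem with $h$ replaced by $h_f$. *)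

(* Defs.v *)
From HB Require Import structures.
From mathcomp Require Import all_boot all_order all_algebra.
From mathcomp Require Import all_classical all_reals all_analysis.
Import Order.TTheory GRing.Theory Num.Theory.
Import numFieldNormedType.Exports.

(* R : realType stands for the real numbers; points of R^d and values of vector
   fields are row vectors. Elements of L^2 are represented by functions. *)

Set Implicit Arguments.
Unset Strict Implicit.
Unset Printing Implicit Defensive.

Local Open Scope classical_set_scope.
Local Open Scope ring_scope.

Definition rV_display : measure_display.
Proof. exact: default_measure_display. Qed.

(* The sigma-algebra on 'rV[R]_n is the product (= Borel) one, generated by
   the coordinate functions. *)
Section measurable_rV.
Context {R : realType} (n : nat).

Definition coor (i : 'I_n) (x : 'rV[R]_n) : measurableTypeR R := x 0 i.

Let rV_set0 : g_sigma_preimage coor set0.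
Proof. exact: sigma_algebra0. Qed.

Let rV_setC A : g_sigma_preimage coor A -> g_sigma_preimage coor (~` A).
Proof. exact: sigma_algebraC. Qed.

Let rV_bigcup (F : _^nat) : (forall i, g_sigma_preimage coor (F i)) ->
  g_sigma_preimage coor (\bigcup_i F i).
Proof. exact: sigma_algebra_bigcup. Qed.

HB.instance Definition _ := @isMeasurable.Build rV_display
  'rV[R]_n (g_sigma_preimage coor) rV_set0 rV_setC rV_bigcup.

End measurable_rV.

Lemma measurable_coor (R : realType) n (i : 'I_n) :
  measurable_fun [set: 'rV[R]_n] (coor i).
Proof.
move=> _ Y mY; rewrite setTI; apply: sub_sigma_algebra => /=.
rewrite -bigcup_seq/=; exists i => /=; first by rewrite mem_index_enum.
by exists Y => //; rewrite setTI.
Qed.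

Lemma measurable_fun_rV (d : measure_display) (T : measurableType d)
    (R : realType) n (f : T -> 'rV[R]_n) :
  (forall i, measurable_fun [set: T] (coor i \o f)) ->
  measurable_fun [set: T] f.
Proof.
move=> mf.
have : g_sigma_preimage (fun i => coor i \o f) `<=` measurable.
  apply: smallest_sub; first exact: sigma_algebra_measurable.
  by move=> A; rewrite -bigcup_seq/= => -[i _ [B mB <-]]; exact: mf.
rewrite g_sigma_preimage_comp => prefS _ A mA.
by apply: prefS; exists A.
Qed.

Definition rV_cons (R : realType) n (p : 'rV[R]_n * measurableTypeR R) :
    'rV[R]_n.+1 :=
  \row_k if unlift ord0 k is Some j then p.1 0 j else p.2.

Lemma measurable_rV_cons (R : realType) n :
  measurable_fun [set: 'rV[R]_n * measurableTypeR R] (@rV_cons R n).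
Proof.
apply: measurable_fun_rV => i; rewrite /rV_cons /coor /comp /=.
under eq_fun do rewrite mxE.
case: (unlift ord0 i) => [j|]; last exact: measurable_snd.
exact: (measurableT_comp (measurable_coor j) measurable_fst).
Qed.

(* n-dimensional Lebesgue measure: the image under rV_cons of the product of
   (n-1)-dimensional and one-dimensional Lebesgue measure. The long constant
   is the library's measure structure on
   pushforward (leb R m \x lebesgue_measure) (@rV_cons R m). *)
Fixpoint leb (R : realType) n : {measure set 'rV[R]_n -> \bar R} :=
  match n with
  | 0 => dirac (0 : 'rV[R]_0)
  | m.+1 => measure_function_pushforward__canonical__measure_function_Measure
     (product_measure1 (leb R m) (@lebesgue_measure R)) (@measurable_rV_cons R m)
  end.

Section function_spaces.
Context {R : realType} {d : nat}.
Local Notation point := 'rV[R]_d.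
Implicit Types (A Om : set point) (f g p q w phi : point -> R)
  (u v : point -> point).

Definition dot (x y : point) : R := (x *m y^T) 0 0.

Definition enorm (x : point) : R := Num.sqrt (dot x x).

Definition diam A : R := sup [set enorm (x - y) | x in A & y in A].

Definition bdry A : set point := closure A `\` A°.

Definition domain A : Prop := [/\ open A, connected A & A !=set0].

Definition L2 A f : Prop :=
  measurable_fun A f /\ (\int[leb R d]_(x in A) ((f x) ^+ 2)%:E < +oo)%E.

Definition L2v A v : Prop := forall l, L2 A (fun x => v x 0 l).

Definition ip A f g : R := \int[leb R d]_(x in A) (f x * g x).

Definition ipv A u v : R := \int[leb R d]_(x in A) dot (u x) (v x).

Definition norm2 A f : R := Num.sqrt (ip A f f).

Definition norm2v A v : R := Num.sqrt (ipv A v v).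

Definition partial (l : 'I_d) f (x : point) : R := 'D_(delta_mx 0 l) f x.

Definition grad f (x : point) : point := \row_l partial l f x.

Definition smooth f : Prop :=
  forall (s : seq 'I_d), continuous (foldr partial f s) /\
    forall l x, derivable (foldr partial f s) x (delta_mx 0 l).

Definition test_function Om phi : Prop :=
  smooth phi /\
  exists Q, [/\ compact Q, Q `<=` Om & forall x, ~ Q x -> phi x = 0].

Definition weak_partial Om (l : 'I_d) w g : Prop :=
  forall phi, test_function Om phi -> ip Om w (partial l phi) = - ip Om g phi.

(* hdiv Om v q: v is in H(div; Om) and q is its weak divergence (unique up to
   null sets). *)
Definition hdiv Om v q : Prop :=
  [/\ L2v Om v, L2 Om q &
      forall phi, test_function Om phi ->
        ipv Om v (grad phi) = - ip Om q phi].

Definition H2_norm_le Om p (c : R) : Prop :=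
  exists (G : 'I_d -> point -> R) (H : 'I_d -> 'I_d -> point -> R),
  [/\ L2 Om p,
      forall k, L2 Om (G k) /\ weak_partial Om k p (G k),
      forall k l, L2 Om (H k l) /\ weak_partial Om l (G k) (H k l) &
      Num.sqrt (norm2 Om p ^+ 2 + \sum_k norm2 Om (G k) ^+ 2
                + \sum_k \sum_l norm2 Om (H k l) ^+ 2) <= c].

End function_spaces.

Section model_problem.
Context {R : realType} {d : nat}.
Local Notation point := 'rV[R]_d.
Implicit Types (Om : set point) (K : point -> 'M[R]_d) (f p : point -> R)
  (u v : point -> point).

(* Two-sided boundedness together with measurability makes the entries of K
   essentially bounded. *)
Definition spd_tensor Om K (kmin kmax : R) : Prop :=
  [/\ 0 < kmin < kmax,
      forall i j, measurable_fun Om (fun x => K x i j),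
      forall x, Om x -> (K x)^T = K x &
      forall x (xi : point), Om x ->
        kmin * dot xi xi <= (xi *m K x *m xi^T) 0 0 <= kmax * dot xi xi].

(* x |-> K(x)^-1 v(x), written for row vectors. *)
Definition Kinv K v : point -> point := fun x => v x *m (invmx (K x))^T.

(* (u, p) is the mixed weak solution with right-hand side f and p = 0 on the
   boundary; du is the divergence of u. *)
Definition exact_solution Om K f u (du : point -> R) p : Prop :=
  [/\ hdiv Om u du, L2 Om p,
      forall v dv, hdiv Om v dv -> ipv Om (Kinv K u) v - ip Om p dv = 0 &
      forall w, L2 Om w -> ip Om du w = ip Om f w].

Definition H2_regular Om K : Prop :=
  exists C : R, forall f u du p, L2 Om f -> exact_solution Om K f u du p ->
    H2_norm_le Om p (C * norm2 Om f).

Definition multiblock Om n (OmI : 'I_n -> set point) : Prop :=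
  [/\ domain Om, forall i, domain (OmI i),
      forall i j, i != j -> OmI i `&` OmI j = set0 &
      Om = (\bigcup_i closure (OmI i))°].

End model_problem.

Section meshes.
Context {R : realType} {d : nat}.
Local Notation point := 'rV[R]_d.

(* The brick with opposite corners T.1 <= T.2; it may be degenerate, which is
   how faces are represented. *)
Local Notation brick := ('rV[R]_d * 'rV[R]_d)%type.
Implicit Types (T e F : brick).

Definition obrick T : set point :=
  [set x | forall l, T.1 0 l < x 0 l < T.2 0 l].

Definition cbrick T : set point :=
  [set x | forall l, T.1 0 l <= x 0 l <= T.2 0 l].

Definition hT T : R := diam (cbrick T).

(* The relatively open side of T orthogonal to the l-th axis; s selects the
   upper one. *)
Definition side T (l : 'I_d) (s : bool) : set point :=
  [set x | x 0 l = (if s then T.2 else T.1) 0 l /\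
           forall k, k != l -> T.1 0 k < x 0 k < T.2 0 k].

(* F is T itself, or a side, edge or vertex of T. *)
Definition face_of F T : Prop :=
  forall l, (F.1 0 l, F.2 0 l) \in
    [:: (T.1 0 l, T.1 0 l); (T.2 0 l, T.2 0 l); (T.1 0 l, T.2 0 l)].

Definition meet T T' : brick :=
  (\row_l Num.max (T.1 0 l) (T'.1 0 l), \row_l Num.min (T.2 0 l) (T'.2 0 l)).

(* For nonoverlapping T and T': they touch along a (d-1)-dimensional piece
   orthogonal to the l-th axis, namely the degenerate brick meet T T', which is
   then the intersection of a side of T with a side of T'. *)
Definition touch (l : 'I_d) T T' : bool :=
  let e := meet T T' in
  (e.1 0 l == e.2 0 l) && [forall k, (k != l) ==> (e.1 0 k < e.2 0 k)].

(* Rectangular partition of the subdomain D; tau measures quasi-uniformity and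
   sigma shape-regularity (the in-radius of T is half its smallest edge). *)
Record partition_of (sigma tau : R) (D : set point) (Th : seq brick) : Prop := {
  part_uniq : uniq Th ;
  part_pos : forall T, T \in Th -> forall l, T.1 0 l < T.2 0 l ;
  part_sub : forall T, T \in Th -> obrick T `<=` D ;
  part_cover : closure D = \bigcup_(T in [set T | T \in Th]) cbrick T ;
  part_disj : forall T T', T \in Th -> T' \in Th -> T != T' ->
    obrick T `&` obrick T' = set0 ;
  part_conforming : forall T T', T \in Th -> T' \in Th ->
    cbrick T `&` cbrick T' !=set0 ->
    face_of (meet T T') T /\ face_of (meet T T') T' ;
  part_quasi_uniform : forall T T', T \in Th -> T' \in Th ->
    hT T <= tau * hT T' ;
  part_shape_regular : forall T, T \in Th -> forall l,
    hT T <= sigma * (T.2 0 l - T.1 0 l)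
}.

Variable n : nat.
(* Th i is the partition of the i-th subdomain. *)
Implicit Types (OmI : 'I_n -> set point) (Th : 'I_n -> seq brick).

Definition mesh_of (sigma tau : R) OmI Th : Prop :=
  forall i, partition_of sigma tau (OmI i) (Th i).

Definition mesh_size Th : R :=
  \big[Num.max/0]_(i < n) \big[Num.max/0]_(T <- Th i) hT T.

Definition refines Th (Tf : 'I_n -> seq brick) : Prop :=
  forall i T', T' \in Tf i ->
    exists2 T, T \in Th i & obrick T' `<=` obrick T.

(* Sum over the interface grid: its elements are the pieces meet T T' with T
   and T' from different subdomains. Taking i < j counts each piece once, and
   touch l T T' holds for at most one l. *)
Definition sum_interface Th (E : 'I_d -> brick -> brick -> R) : R :=
  \sum_(i < n) \sum_(j < n | (i < j)%N) \sum_(T <- Th i) \sum_(T' <- Th j)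
    \sum_(l < d | touch l T T') E l T T'.

End meshes.

Section discrete.
Context {R : realType} {d n : nat}.
Local Notation point := 'rV[R]_d.
Local Notation brick := ('rV[R]_d * 'rV[R]_d)%type.
Implicit Types (Om D G : set point) (OmI : 'I_n -> set point)
  (Th : 'I_n -> seq brick) (T e : brick) (K : point -> 'M[R]_d)
  (f p w : point -> R) (u v : point -> point).

(* One-sided boundary value at x, taken from inside T. *)
Definition trace T p (x : point) : R := lim (p @ within (obrick T) (nbhs x)).

Definition RT0 T v : Prop :=
  exists al be : point, forall x, obrick T x ->
    v x = \row_l (al 0 l + be 0 l * x 0 l).

Definition Vhi D (Ti : seq brick) v : Prop :=
  (exists q, hdiv D v q) /\ (forall T, T \in Ti -> RT0 T v).

(* Members are extended by zero outside the subdomain D. *)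
Definition Vhi0 Om D (Ti : seq brick) v : Prop :=
  [/\ Vhi D Ti v, forall x, ~ D x -> v x = 0 &
      forall T, T \in Ti -> forall l s x, side T l s x ->
        (bdry D `\` bdry Om) x -> trace T (fun y => v y 0 l) x = 0].

(* The sub-element of T obtained by extending the interface piece e, orthogonal
   to the l-th axis, into T. *)
Definition sub_element (l : 'I_d) T e : brick :=
  (\row_k (if k == l then T.1 else e.1) 0 k,
   \row_k (if k == l then T.2 else e.2) 0 k).

(* v is the Raviart-Thomas function on Tk with normal component 1 on e and 0 on
   the other sides, extended by zero. *)
Definition side_function Tk e v : Prop :=
  [/\ RT0 Tk v, forall x, ~ obrick Tk x -> v x = 0 &
      forall l s x, side Tk l s x ->
        trace Tk (fun y => v y 0 l) x = \1_(cbrick e) x].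

Definition VGamma_generator Th v : Prop :=
  exists i j T T' l,
  [/\ i != j, T \in Th i, T' \in Th j, touch l T T' &
      side_function (sub_element l T (meet T T')) (meet T T') v].

Definition VGamma Th v : Prop :=
  exists N (c : 'I_N -> R) (b : 'I_N -> point -> point),
    (forall k, VGamma_generator Th (b k)) /\
    (forall x, v x = \sum_k c k *: b k x).

(* The sum is an equality in L^2(Om). *)
Definition Vstar Om OmI Th v : Prop :=
  (exists q, hdiv Om v q) /\
  exists (vI : 'I_n -> point -> point) (vG : point -> point),
  [/\ forall i, Vhi0 Om (OmI i) (Th i) (vI i), VGamma Th vG &
      {ae leb R d, forall x, Om x -> v x = \sum_i vI i x + vG x}].

(* Members are represented by functions that are constant at every point of
   each open element; values on the (null) skeleton are irrelevant. *)
Definition Wh Om Th w : Prop :=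
  L2 Om w /\
  forall i T, T \in Th i -> exists c, forall x, obrick T x -> w x = c.

Definition discrete_solution Om OmI Th K f u (du : point -> R) p : Prop :=
  [/\ Vstar Om OmI Th u, hdiv Om u du, Wh Om Th p,
      forall v dv, Vstar Om OmI Th v -> hdiv Om v dv ->
        ipv Om (Kinv K u) v = ip Om p dv &
      forall w, Wh Om Th w -> ip Om du w = ip Om f w].

(* Saturation with respect to the mesh Th: there is a refined mesh Tf of size
   h / m, m >= 2, with nested spaces, on which the discrete solution
   (uf, pf) contracts the errors of (uh, ph) by beta and alpha. *)
Definition saturation (sigma tau alpha beta : R) Om OmI K f u p Th
    (uh : point -> point) (ph : point -> R) : Prop :=
  exists (m : nat) (Tf : 'I_n -> seq brick) uf duf pf,
  [/\ (2 <= m)%N,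
      [/\ mesh_of sigma tau OmI Tf, refines Th Tf &
          mesh_size Tf = mesh_size Th / m%:R],
      (forall v, Vstar Om OmI Th v -> Vstar Om OmI Tf v) /\
      (forall w, Wh Om Th w -> Wh Om Tf w),
      discrete_solution Om OmI Tf K f uf duf pf &
      norm2v Om (u \- uf) <= beta * norm2v Om (u \- uh) /\
      norm2 Om (p \- pf) <= alpha * norm2 Om (p \- ph)].

Definition hyperplane (l : 'I_d) (c : R) (y : 'rV[R]_d.-1) : point :=
  \row_k if unlift l k is Some j then y 0 j else c.

(* Squared L^2 norm, for (d-1)-dimensional Lebesgue measure, over a piece e
   orthogonal to the l-th axis. *)
Definition side_norm2_sq (l : 'I_d) e p : R :=
  \int[leb R d.-1]_(y in [set y | cbrick e (hyperplane l (e.1 0 l) y)])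
    (p (hyperplane l (e.1 0 l) y)) ^+ 2.

Definition jump T T' p (x : point) : R := trace T p x - trace T' p x.

Definition estimator Th K f (uh : point -> point) (duh ph : point -> R) : R :=
  \sum_(i < n) \sum_(T <- Th i)
    (norm2v (obrick T) (Kinv K uh \+ grad ph) ^+ 2
     + norm2 (obrick T) (f \- duh) ^+ 2 * hT T ^+ 2)
  + sum_interface Th (fun l T T' =>
      side_norm2_sq l (meet T T') (jump T T' ph) / diam (cbrick (meet T T'))).

End discrete.

(* Main.v *)
From HB Require Import structures.
Require Import Defs.
From mathcomp Require Import all_boot all_order all_algebra.
From mathcomp Require Import all_classical all_reals all_analysis.
From mathcomp Require Import measurable_realfun ring lra.
Import Order.TTheory GRing.Theory Num.Theory.
Import numFieldNormedType.Exports.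

(** The elementwise gradient of a piecewise constant pressure vanishes, so the
    estimator controls the norm of [K^-1 uh] together with the weighted
    residuals [h_T ||f - div uh||_T]. Let [e = u - uh]. Coercivity of [K^-1]
    bounds [||e||^2] by a multiple of
      [(K^-1 e, e) = (K^-1 u, e) - (K^-1 uh, e)],
    and the second pairing is at most [||K^-1 uh|| ||e||].

    For the first one, the exact equations give
      [(K^-1 u, e) = (p, div u - div uh) = (p, f - div uh)],
    a sum over the elements. On each element [T] the residual [f - div uh] has
    mean zero, because the discrete mass balance holds on [T]. It is therefore
    the divergence of a field [v_T] supported in [T] with zero normal component
    on the boundary of [T] and norm at most [C h_T ||f - div uh||_T]. Extended
    by zero, [v_T] is admissible in the first exact equation, which reads
      [(p, f - div uh)_T = (K^-1 u, v_T)],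
    hence
      [|(K^-1 u, e)| <= C ||K^-1 u|| (sum_T h_T^2 ||f - div uh||_T^2)^(1/2)].
    Since [||K^-1 u|| <= ||K^-1 e|| + ||K^-1 uh||], Young's inequality absorbs
    the error terms of the right side.

    The field [v_T] is built one coordinate at a time
    ([brick_divergence]): averaging over the edge parallel to a coordinate axis
    leaves a remainder that has mean zero along that edge and is the derivative
    of a primitive vanishing at both ends, while the average is a function of one
    variable fewer, still of mean zero. [element_duality] is the resulting bound
    on one element and [flux_error_le] assembles the pieces. *)

Set Implicit Arguments.
Unset Strict Implicit.
Unset Printing Implicit Defensive.

Local Open Scope classical_set_scope.
Local Open Scope ring_scope.

(** * Square-integrable functions *)

Section square_integrable.
Context d (T : measurableType d) (R : realType).
Variables (mu : {measure set T -> \bar R}) (D : set T) (mD : measurable D).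
Implicit Types f g h : T -> R.

(** [L2] of the problem is the case of the measure [leb R d]. The general
    measure serves the one-dimensional slices and the product spaces. *)
Definition square_integrable f : Prop :=
  measurable_fun D f /\ (\int[mu]_(x in D) ((f x) ^+ 2)%:E < +oo)%E.

Lemma square_integrable_sqr f : square_integrable f ->
  mu.-integrable D (EFin \o (fun x => f x ^+ 2)).
Proof.
move=> [mf fD]; apply/integrableP; split.
  by apply/measurable_EFinP; exact: measurable_funX.
under eq_integral do rewrite /= ger0_norm ?sqr_ge0//.
exact: fD.
Qed.

Lemma le_square_integrable f h : measurable_fun D f ->
  mu.-integrable D (EFin \o h) -> (forall x, D x -> f x ^+ 2 <= h x) ->
  square_integrable f.
Proof.
move=> mf ih fh; split => //.
have : mu.-integrable D (EFin \o (fun x => f x ^+ 2)).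
  apply: (le_integrable mD _ _ ih).
    by apply/measurable_EFinP; exact: measurable_funX.
  move=> x Dx /=; rewrite lee_fin ger0_norm ?sqr_ge0//.
  exact: le_trans (fh x Dx) (ler_norm _).
move=> /integrableP[_]; apply: le_lt_trans.
apply: ge0_le_integral => //=.
- by move=> x _; rewrite lee_fin sqr_ge0.
- by apply/measurable_EFinP; exact: measurable_funX.
- apply/measurable_EFinP; apply: measurableT_comp => //.
  exact: measurable_funX.
- by move=> x _; rewrite lee_fin ler_norm.
Qed.

Lemma integrableD_real f g : mu.-integrable D (EFin \o f) ->
  mu.-integrable D (EFin \o g) ->
  mu.-integrable D (EFin \o (fun x => f x + g x)).
Proof. by move=> hf hg; have := integrableD mD hf hg. Qed.

Lemma integrableB_real f g : mu.-integrable D (EFin \o f) ->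
  mu.-integrable D (EFin \o g) ->
  mu.-integrable D (EFin \o (fun x => f x - g x)).
Proof. by move=> hf hg; have := integrableB mD hf hg. Qed.

Lemma integrableZ_real (c : R) f : mu.-integrable D (EFin \o f) ->
  mu.-integrable D (EFin \o (fun x => c * f x)).
Proof. by move=> hf; have := integrableZl mD c hf. Qed.

Lemma integrable_sum_real I (s : seq I) (F : I -> T -> R) :
  (forall i, mu.-integrable D (EFin \o F i)) ->
  mu.-integrable D (EFin \o (fun x => \sum_(i <- s) F i x)).
Proof.
move=> iF; elim: s => [|i s ih].
  by under eq_fun do rewrite big_nil; exact: integrable0.
by under eq_fun do rewrite big_cons; exact: integrableD_real.
Qed.

Lemma Rintegral_sum I (s : seq I) (F : I -> T -> R) :
  (forall i, mu.-integrable D (EFin \o F i)) ->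
  \int[mu]_(x in D) (\sum_(i <- s) F i x) =
  \sum_(i <- s) \int[mu]_(x in D) F i x.
Proof.
move=> iF; elim: s => [|i s ih].
  under eq_Rintegral do rewrite big_nil.
  by rewrite big_nil Rintegral_cst// mul0r.
under eq_Rintegral do rewrite big_cons.
by rewrite big_cons RintegralD//; [rewrite ih|exact: integrable_sum_real].
Qed.

Lemma square_integrableM f g : square_integrable f -> square_integrable g ->
  mu.-integrable D (EFin \o (fun x => f x * g x)).
Proof.
move=> sf sg.
have := integrableD_real (square_integrable_sqr sf) (square_integrable_sqr sg).
apply: le_integrable => //.
  apply/measurable_EFinP.
  by apply: measurable_funM; [exact: sf.1|exact: sg.1].
move=> x Dx; rewrite /= lee_fin (ger0_norm (addr_ge0 _ _)) ?sqr_ge0//.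
rewrite ler_norml; apply/andP; split.
  have := sqr_ge0 (f x + g x); have := sqr_ge0 (f x); have := sqr_ge0 (g x); nra.
have := sqr_ge0 (f x - g x); have := sqr_ge0 (f x); have := sqr_ge0 (g x); nra.
Qed.

Lemma square_integrableD f g : square_integrable f -> square_integrable g ->
  square_integrable (fun x => f x + g x).
Proof.
move=> sf sg; apply: (@le_square_integrable _
  (fun x => 2 * (f x ^+ 2 + g x ^+ 2))).
- by apply: measurable_funD; [exact: sf.1|exact: sg.1].
- apply: integrableZ_real.
  by apply: integrableD_real; exact: square_integrable_sqr.
- by move=> x _; have := sqr_ge0 (f x - g x); nra.
Qed.

Lemma square_integrableZ (c : R) f : square_integrable f ->
  square_integrable (fun x => c * f x).
Proof.
move=> sf; apply: (@le_square_integrable _ (fun x => c ^+ 2 * (f x ^+ 2))).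
- by apply: measurable_funM; [exact: measurable_cst|exact: sf.1].
- by apply: integrableZ_real; exact: square_integrable_sqr.
- by move=> x _; rewrite exprMn.
Qed.

Lemma square_integrableB f g : square_integrable f -> square_integrable g ->
  square_integrable (fun x => f x - g x).
Proof.
move=> sf sg; under eq_fun do rewrite -[- g _]mulN1r.
by apply: square_integrableD => //; exact: square_integrableZ.
Qed.

End square_integrable.

Section square_integrable_restrict.
Context d (T : measurableType d) (R : realType).
Variables (mu : {measure set T -> \bar R}).
Implicit Types (D A : set T) (f : T -> R).

Lemma sqr_restrict D f (x : T) : (f \_ D) x ^+ 2 = ((fun x => f x ^+ 2) \_ D) x.
Proof. by rewrite /patch; case: ifP => // _; rewrite expr0n. Qed.

Lemma square_integrable_restrict D f : measurable D ->
  square_integrable mu D f -> square_integrable mu setT (f \_ D).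
Proof.
move=> mD [mf fD]; split.
  by apply/(measurable_restrictT f mD).
have -> : (fun x => ((f \_ D) x ^+ 2)%:E) = (EFin \o (fun x => f x ^+ 2)) \_ D.
  by rewrite restrict_EFin; apply/funext => x /=; rewrite sqr_restrict.
by rewrite -integral_mkcond.
Qed.

Lemma square_integrableS D A f : measurable D -> measurable A -> A `<=` D ->
  square_integrable mu D f -> square_integrable mu A f.
Proof.
move=> mD mA AD sf.
have iA := integrableS mD mA AD (square_integrable_sqr sf).
apply: (le_square_integrable mA _ iA) => //.
exact: measurable_funS sf.1.
Qed.

End square_integrable_restrict.

Section square_integrable_bounds.
Context d (T : measurableType d) (R : realType).
Variable mu : {measure set T -> \bar R}.
Implicit Types f : T -> R.

Lemma square_integrable_EFin f : square_integrable mu setT f ->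
  (\int[mu]_x (f x ^+ 2)%:E = (\int[mu]_x (f x ^+ 2))%:E)%E.
Proof.
move=> [_ fi]; rewrite /Rintegral fineK// ge0_fin_numE//.
by apply: integral_ge0 => x _; rewrite lee_fin sqr_ge0.
Qed.

Lemma square_integrable_le f (M : R) : measurable_fun setT f ->
  (\int[mu]_x (f x ^+ 2)%:E <= M%:E)%E ->
  square_integrable mu setT f /\ \int[mu]_x (f x ^+ 2) <= M.
Proof.
move=> mf fM; have sf : square_integrable mu setT f.
  by split => //; apply: le_lt_trans fM _; rewrite ltry.
by split => //; rewrite -lee_fin -square_integrable_EFin.
Qed.

Lemma integrable_indic_lty (A : set T) : measurable A -> (mu A < +oo)%E ->
  mu.-integrable setT (EFin \o (\1_A : T -> R)).
Proof.
move=> mA muA; apply/integrableP; split.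
  by apply/measurable_EFinP; exact: measurable_indic.
under eq_integral do rewrite /= ger0_norm//.
by rewrite integral_indic// setIT.
Qed.

Lemma square_integrable_indic (A : set T) : measurable A -> (mu A < +oo)%E ->
  square_integrable mu setT (\1_A : T -> R).
Proof.
move=> mA muA.
apply: (le_square_integrable measurableT _ (integrable_indic_lty mA muA)).
  exact: measurable_indic.
by move=> x _; rewrite indicE; case: (x \in _); rewrite ?expr1n ?expr0n.
Qed.

Lemma square_integrable_integrable f (A : set T) : measurable A ->
  (mu A < +oo)%E -> (forall x, ~ A x -> f x = 0) ->
  square_integrable mu setT f -> mu.-integrable setT (EFin \o f).
Proof.
move=> mA muA fA sf.
have iA : mu.-integrable setT (EFin \o (\1_A : T -> R)) by exact: integrable_indic_lty.
have := integrableD_real measurableT iA (square_integrable_sqr sf).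
apply: le_integrable => //; first by apply/measurable_EFinP; exact: sf.1.
move=> x _; rewrite /= lee_fin indicE.
have [xA|xA] := boolP (x \in A); last first.
  by rewrite fA ?normr0//; apply/set_mem; rewrite in_setC.
rewrite (ger0_norm (addr_ge0 _ _)) ?sqr_ge0// -[X in _ <= _ + X]real_normK ?num_real//.
have := sqr_ge0 (`|f x| - 1); have := normr_ge0 (f x); simpl; nra.
Qed.

Lemma integrableM_bounded (M : R) (f q : T -> R) :
  (forall x, `|q x| <= M) -> measurable_fun setT q ->
  mu.-integrable setT (EFin \o f) ->
  mu.-integrable setT (EFin \o (fun x => f x * q x)).
Proof.
move=> bq mq fi; have := integrableZ_real measurableT M fi.
apply: le_integrable => //.
  apply/measurable_EFinP; apply: measurable_funM => //.
  by apply/measurable_EFinP; exact: measurable_int fi.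
move=> x _; rewrite /= lee_fin !normrM mulrC.
by apply: ler_wpM2r => //; apply: le_trans (bq x) (ler_norm _).
Qed.

Lemma ae_eq_Rintegral (D : set T) (f g : T -> R) : measurable D ->
  mu.-integrable D (EFin \o f) -> mu.-integrable D (EFin \o g) ->
  {ae mu, forall x, D x -> f x = g x} ->
  \int[mu]_(x in D) f x = \int[mu]_(x in D) g x.
Proof.
move=> mD fi gi fg; congr fine; apply: ae_eq_integral => //.
- exact: measurable_int fi.
- exact: measurable_int gi.
- by apply: filterS fg => x /= fg /fg ->.
Qed.

End square_integrable_bounds.

(** * Measurability and Lebesgue measure on row vectors *)

Section rV_measurable.
Context {R : realType}.

Lemma measurable_obrick n (T : 'rV[R]_n * 'rV[R]_n) : measurable (obrick T).
Proof.
have -> : obrick T =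
    \bigcap_(l in [set: 'I_n]) (coor l @^-1` `]T.1 0 l, T.2 0 l[%classic).
  apply/seteqP; split => [x Tx l _|x Tx l] /=.
    by rewrite in_itv/=; exact: Tx.
  by have := Tx l I; rewrite /= in_itv.
apply: fin_bigcap_measurable => // l _; rewrite -[X in measurable X]setTI.
exact: measurable_coor.
Qed.

(** The sigma-algebra is generated by the coordinates and the open sets come
    from the sup norm. The two are related by second countability: an open set
    is the union of the bricks with rational corners that it contains. *)
Lemma open_rV_measurable n (A : set 'rV[R]_n) : open A -> measurable A.
Proof.
move=> oA.
pose q (r : 'rV[rat]_n * 'rV[rat]_n) : 'rV[R]_n * 'rV[R]_n :=
  (map_mx ratr r.1, map_mx ratr r.2).
pose F r := if `[< obrick (q r) `<=` A >] then obrick (q r) else set0.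
have -> : A = \bigcup_r F r.
  apply/seteqP; split => [x Ax|x [r _]]; last first.
    by rewrite /F; case: asboolP => // + rx; exact.
  have := open_nbhs_nbhs (conj oA Ax) => /nbhs_ballP[e /= e0 xeA].
  have ex1 (l : 'I_n) : exists r : rat, x 0 l - e < ratr r < x 0 l.
    have /rat_in_itvoo[r] : x 0 l - e < x 0 l by lra.
    by rewrite in_itv/= => ?; exists r.
  have ex2 (l : 'I_n) : exists r : rat, x 0 l < ratr r < x 0 l + e.
    have /rat_in_itvoo[r] : x 0 l < x 0 l + e by lra.
    by rewrite in_itv/= => ?; exists r.
  have [a aP] := choice ex1; have [b bP] := choice ex2.
  exists (\row_l a l, \row_l b l) => //.
  rewrite /F; case: asboolP => [_ l|].
    by rewrite !mxE; have /andP[_ ->] := aP l; have /andP[-> _] := bP l.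
  case=> y yab; apply: xeA; split => // i l; rewrite !ord1.
  have := yab l; rewrite !mxE => /andP[ay yb].
  have /andP[xa ax] := aP l; have /andP[xb bx] := bP l.
  by rewrite /ball/= ltr_norml; apply/andP; split; lra.
apply: countable_bigcupT_measurable => // r.
by rewrite /F; case: asboolP => // _; exact: measurable_obrick.
Qed.

Lemma continuous_rV_measurable n (phi : 'rV[R]_n -> R) :
  continuous phi -> measurable_fun setT phi.
Proof.
move=> cphi; apply: (measurability _ (RGenOpens.measurableE R)).
move=> _ [_ [a [b ->] <-]]; rewrite setTI; apply: open_rV_measurable.
by apply: open_comp => // y _; exact: cphi.
Qed.

Definition rV_uncons n (x : 'rV[R]_n.+1) : 'rV[R]_n * measurableTypeR R :=
  (\row_j x 0 (lift ord0 j), x 0 ord0).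

Lemma rV_consK n : cancel (@rV_cons R n) (@rV_uncons n).
Proof.
case=> y t; rewrite /rV_uncons /rV_cons; congr pair.
  by apply/rowP => j; rewrite !mxE liftK.
by rewrite mxE unlift_none.
Qed.

Lemma rV_unconsK n : cancel (@rV_uncons n) (@rV_cons R n).
Proof.
move=> x; apply/rowP => j; rewrite !mxE.
by case: unliftP => [k ->|->]; rewrite ?mxE.
Qed.

Lemma measurable_rV_uncons n : measurable_fun setT (@rV_uncons n).
Proof.
apply/measurable_fun_pairP; split; last exact: (measurable_coor ord0).
apply: measurable_fun_rV => i.
rewrite (_ : _ \o _ = coor (lift ord0 i)); first exact: measurable_coor.
by apply/funext => x; rewrite /= /coor mxE.
Qed.

Lemma rV_cons0 n (p : 'rV[R]_n * measurableTypeR R) : rV_cons p 0 ord0 = p.2.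
Proof. by rewrite mxE unlift_none. Qed.

Lemma rV_consS n (p : 'rV[R]_n * measurableTypeR R) j :
  rV_cons p 0 (lift ord0 j) = p.1 0 j.
Proof. by rewrite mxE liftK. Qed.

Lemma obrick_cons n (T : 'rV[R]_n.+1 * 'rV[R]_n.+1) p :
  obrick T (rV_cons p) <->
  obrick ((rV_uncons T.1).1, (rV_uncons T.2).1) p.1 /\
  T.1 0 ord0 < p.2 < T.2 0 ord0.
Proof.
split => [Tp|[Tp1 Tp2] l].
  split; last by have := Tp ord0; rewrite rV_cons0.
  by move=> l; have := Tp (lift ord0 l); rewrite rV_consS /= !mxE.
case: (unliftP ord0 l) => [j ->|->]; last by rewrite rV_cons0.
by rewrite rV_consS; have := Tp1 j; rewrite !mxE.
Qed.

Lemma leb_succE n (A : set 'rV[R]_n.+1) :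
  leb R n.+1 A = (leb R n \x @lebesgue_measure R)%E (@rV_cons R n @^-1` A).
Proof. by []. Qed.

Lemma leb_obrick_lty n (T : 'rV[R]_n * 'rV[R]_n) : (leb R n (obrick T) < +oo)%E.
Proof.
elim: n T => [|n ih] T.
  by rewrite /= diracE ltry.
rewrite leb_succE (_ : _ @^-1` _ =
    obrick ((rV_uncons T.1).1, (rV_uncons T.2).1) `*`
    (`]T.1 0 ord0, T.2 0 ord0[%classic : set (measurableTypeR R))); last first.
  apply/seteqP; split => p.
    by move=> /obrick_cons[? ?]; split => //=; rewrite in_itv.
  by move=> [? /=]; rewrite in_itv/= => ?; apply/obrick_cons.
rewrite product_measure1E//; last exact: measurable_obrick.
apply: lte_mul_pinfty => //; first by rewrite ge0_fin_numE.
have itv_lty (a b : R) : (lebesgue_measure (`]a, b[%classic : set R) < +oo)%E.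
  by rewrite lebesgue_measure_itv/=; case: ifP => _; rewrite ?ltry// -EFinB ltry.
exact: itv_lty.
Qed.

Lemma leb_sigma_finite n : sigma_finite setT (leb R n).
Proof.
exists (fun k => obrick (const_mx (- k%:R), const_mx k%:R)); last first.
  by move=> k; split; [exact: measurable_obrick|exact: leb_obrick_lty].
apply/seteqP; split => // x _.
pose M := \sum_l `|x 0 l|.
exists (Num.truncn M).+1 => // l; rewrite !mxE -ltr_norml.
apply: le_lt_trans (truncnS_gt M).
by rewrite /M (bigD1 l)//= lerDl; exact: sumr_ge0.
Qed.

(** The measure [leb R n] again, under a name that carries the
    sigma-finiteness on which the theorem of Fubini relies. *)
Definition lebS n : set 'rV[R]_n -> \bar R := leb R n.
HB.instance Definition _ n := Measure.on (@lebS n).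
HB.instance Definition _ n := Measure_isSigmaFinite.Build rV_display 'rV[R]_n R
  (@lebS n) (@leb_sigma_finite n).

End rV_measurable.

(** * Iterated integrals of real-valued functions *)

Section real_fubini.
Context d1 d2 (X : measurableType d1) (Y : measurableType d2) (R : realType).
Variables (m1 : {sigma_finite_measure set X -> \bar R})
          (m2 : {sigma_finite_measure set Y -> \bar R}).
Implicit Types F : X * Y -> R.

(** The integral of a signed function is by definition a difference of two
    Tonelli integrals, each of them measurable in the parameter. The value [0]
    that [fine] gives to infinities covers the slices that are not
    integrable. *)
Lemma measurable_Rintegral_param F : measurable_fun setT F ->
  measurable_fun setT (fun x => \int[m2]_y F (x, y)).
Proof.
move=> mF; apply: measurableT_comp => //.
have mEF : measurable_fun setT (EFin \o F) by exact/measurable_EFinP.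
rewrite (_ : (fun x => _) = fun x => (\int[m2]_y ((EFin \o F)^\+ (x, y)) -
    \int[m2]_y ((EFin \o F)^\- (x, y)))%E); last first.
  apply/funext => x; rewrite [LHS]integralE.
  by congr (_ - _)%E; apply: eq_integral => y _;
    [rewrite (funepos_comp (EFin \o F) (pair x))
    |rewrite (funeneg_comp (EFin \o F) (pair x))].
apply: emeasurable_funB.
  by apply: (@measurable_fun_fubini_tonelli_F _ _ _ _ _ m2
    ((EFin \o F)^\+)%E) => //; exact: measurable_funepos.
by apply: (@measurable_fun_fubini_tonelli_F _ _ _ _ _ m2
  ((EFin \o F)^\-)%E) => //; exact: measurable_funeneg.
Qed.

Lemma integrable_fine d (T : measurableType d)
    (mu : {measure set T -> \bar R}) (f : T -> \bar R) :
  mu.-integrable setT f ->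
  mu.-integrable setT (EFin \o (fun x => fine (f x))) /\
  \int[mu]_x fine (f x) = fine (\int[mu]_x f x)%E.
Proof.
move=> fi.
have mf : measurable_fun setT (EFin \o (fun x => fine (f x))).
  by apply/measurable_EFinP; apply: measurableT_comp => //;
    exact: measurable_int fi.
have fE : ae_eq mu setT f (EFin \o (fun x => fine (f x))).
  have := integrable_ae measurableT fi.
  by apply: filterS => x + _ => /(_ I) fx /=; rewrite fineK.
split; last first.
  by congr fine; apply/esym/ae_eq_integral => //; exact: measurable_int fi.
apply: (le_integrable measurableT mf _ fi) => x _ /=.
by case: (f x) => //=; rewrite normr0 ?leey.
Qed.

Lemma Rfubini1 F : (m1 \x m2)%E.-integrable setT (EFin \o F) ->
  m1.-integrable setT (EFin \o (fun x => \int[m2]_y F (x, y))) /\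
  \int[m1]_x (\int[m2]_y F (x, y)) = \int[(m1 \x m2)%E]_z F z.
Proof.
move=> iF; have [? E] := integrable_fine (integrable_fubini_F iF).
by split => //; rewrite E (integral12_prod_meas1 iF).
Qed.

Lemma Rfubini2 F : (m1 \x m2)%E.-integrable setT (EFin \o F) ->
  m2.-integrable setT (EFin \o (fun y => \int[m1]_x F (x, y))) /\
  \int[m2]_y (\int[m1]_x F (x, y)) = \int[(m1 \x m2)%E]_z F z.
Proof.
move=> iF; have mF : measurable_fun setT (EFin \o F) := measurable_int _ iF.
have iG : m2.-integrable setT (fubini_G m1 (EFin \o F)).
  apply/integrableP; split; first exact: measurable_fubini_G iF.
  apply: le_lt_trans ((integrable21ltyP m1 m2 mF).1 iF).
  apply: ge0_le_integral => //.
  - by apply: measurableT_comp => //; exact: measurable_fubini_G iF.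
  - apply: (@measurable_fun_fubini_tonelli_G _ _ _ _ _ m1 (abse \o (EFin \o F))).
      exact: measurableT_comp.
    by move=> z; exact: abse_ge0.
  - move=> y _; apply: le_abse_integral => //.
    exact: (measurableT_comp mF).
have [? E] := integrable_fine iG.
by split => //; rewrite E (integral21_prod_meas1 iF).
Qed.

Lemma integrable_prod_le F (f : X -> R) (g : Y -> R) :
  measurable_fun setT F ->
  m1.-integrable setT (EFin \o f) -> m2.-integrable setT (EFin \o g) ->
  (forall x y, `|F (x, y)| <= `|f x| * `|g y|) ->
  (m1 \x m2)%E.-integrable setT (EFin \o F).
Proof.
move=> mF /integrableP[mf fi] /integrableP[mg gi] Ffg.
have mEF : measurable_fun setT (EFin \o F) by exact/measurable_EFinP.
have mEFa : measurable_fun setT (abse \o (EFin \o F)).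
  exact: measurableT_comp.
apply/integrable12ltyP => //.
pose c := (\int[m2]_y `|(g y)%:E|)%E.
have c0 : (0 <= c)%E by exact: integral_ge0.
apply: (@le_lt_trans _ _ (\int[m1]_x (`|(f x)%:E| * c))%E).
  apply: ge0_le_integral => //.
  - by move=> x _; exact: integral_ge0.
  - apply: (@measurable_fun_fubini_tonelli_F _ _ _ _ _ m2 (abse \o (EFin \o F))) => //.
    by move=> z; exact: abse_ge0.
  - by apply: emeasurable_funM => //; exact: measurableT_comp.
  move=> x _; rewrite -ge0_integralZl//; last exact: measurableT_comp.
  apply: ge0_le_integral => //.
  - exact: (measurableT_comp mEFa).
  - apply: measurable_funeM; exact: measurableT_comp.
  - by move=> y _; rewrite /= -EFinM lee_fin.
rewrite ge0_integralZr//; last exact: measurableT_comp.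
rewrite lte_mul_pinfty//; first exact: integral_ge0.
by rewrite ge0_fin_numE//; exact: integral_ge0.
Qed.

End real_fubini.

(** * Primitives on an interval *)

Section interval_primitive.
Context {R : realType}.
Notation leb1 := (@lebesgue_measure R).
Implicit Types (a b s t M : R) (h psi : R -> R).

Lemma measurable_indic_lt d (T : measurableType d) (f g : T -> R) :
  measurable_fun setT f -> measurable_fun setT g ->
  measurable_fun setT (fun z => \1_`]-oo, g z[%classic (f z) : R).
Proof.
move=> mf mg; rewrite [X in measurable_fun _ X](_ : _ = \1_[set z | f z < g z]).
  apply: measurable_indic; rewrite -[X in measurable X]setTI.
  by have := measurable_fun_ltr mf mg => /(_ measurableT [set true]); exact.
by apply/funext => z; rewrite !indicE; congr (nat_of_bool _)%:R;
  apply/idP/idP => /set_mem/= H; apply/mem_set => /=; move: H; rewrite in_itv.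
Qed.

Lemma Rintegral_indic_itv (i : interval R) h :
  \int[leb1]_t (\1_[set` i] t * h t) = \int[leb1]_(t in [set` i]) h t.
Proof.
rewrite [RHS]Rintegral_mkcond; apply: eq_Rintegral => t _.
by rewrite patchE indicE; case: ifPn => _; rewrite ?mul1r ?mul0r.
Qed.

Lemma integrable_indicM (A : set R) h : measurable A ->
  leb1.-integrable setT (EFin \o h) ->
  leb1.-integrable setT (EFin \o (fun t => \1_A t * h t)).
Proof.
move=> mA hi; apply: (le_integrable measurableT _ _ hi).
  apply/measurable_EFinP; apply: measurable_funM; first exact: measurable_indic.
  by apply/measurable_EFinP; exact: measurable_int hi.
move=> t _; rewrite /= lee_fin normrM indicE.
by case: (t \in A); rewrite ?normr1 ?mul1r// normr0 mul0r.
Qed.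

(** The Cauchy-Schwarz inequality against the indicator of the interval. It
    expresses that the square of the deviation of [h] from its mean over the
    interval has a nonnegative integral. *)
Lemma square_Rintegral_le a b h : a < b -> square_integrable leb1 setT h ->
  (forall t, ~~ (a < t < b) -> h t = 0) ->
  leb1.-integrable setT (EFin \o h) /\
  (\int[leb1]_t h t) ^+ 2 <= (b - a) * \int[leb1]_t (h t ^+ 2).
Proof.
move=> ab sh h0.
have chi : square_integrable leb1 setT (\1_`]a, b[%classic : R -> R).
  apply: (@le_square_integrable _ (measurableTypeR R) R leb1 setT measurableT _
    (\1_`]a, b[%classic : R -> R)).
  - exact: measurable_indic.
  - by apply: integrable_indic_itv.
  - by move=> x _; rewrite indicE; case: (x \in _); rewrite ?expr1n ?expr0n.
have hE t : h t = \1_`]a, b[%classic t * h t.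
  rewrite indicE; case: (boolP (t \in _)); first by rewrite mul1r.
  by rewrite mul0r notin_setE/= in_itv/= => /negP/h0.
have hi : leb1.-integrable setT (EFin \o h).
  by rewrite (funext hE); exact: square_integrableM chi sh.
split => //.
set I1 := \int[leb1]_t h t; set I2 := \int[leb1]_t (h t ^+ 2).
pose c := I1 / (b - a).
have ba : 0 < b - a by rewrite subr_gt0.
have : 0 <= \int[leb1]_t ((h t - c * \1_`]a, b[%classic t) ^+ 2).
  by apply: Rintegral_ge0 => t _; exact: sqr_ge0.
have -> : \int[leb1]_t ((h t - c * \1_`]a, b[%classic t) ^+ 2) =
    \int[leb1]_t (h t ^+ 2 - 2 * c * h t + c ^+ 2 * (\1_`]a, b[%classic t ^+ 2)).
  apply: eq_Rintegral => t _; rewrite {3}hE; ring.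
have i2 := square_integrable_sqr sh.
have ic := square_integrable_sqr chi.
rewrite RintegralD//; last 2 first.
  by apply: integrableB_real => //; exact: integrableZ_real.
  exact: integrableZ_real.
rewrite RintegralB//; last exact: integrableZ_real.
rewrite !RintegralZl// -/I1 -/I2.
have -> : \int[leb1]_t (\1_`]a, b[%classic t ^+ 2) = b - a.
  under eq_Rintegral do rewrite expr2.
  rewrite Rintegral_indic_itv.
  have -> : \int[leb1]_(t in `]a, b[) (\1_`]a, b[%classic t : R) =
      \int[leb1]_(t in `]a, b[) cst 1 t.
    by apply: eq_Rintegral => t tab; rewrite indicE tab.
  rewrite Rintegral_cst// mul1r.
  suff E : lebesgue_measure (`]a, b[%classic : set R) = (b - a)%:E.
    exact: (congr1 fine E).
  by rewrite lebesgue_measure_itv/= lte_fin ab.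
suff -> : I2 - 2 * c * I1 + c ^+ 2 * (b - a) = I2 - I1 ^+ 2 / (b - a).
  by rewrite subr_ge0 ler_pdivrMr// mulrC.
by rewrite /c; field; rewrite gt_eqF.
Qed.

(** Cut off to [0] outside the interval. For [h] of mean zero supported in the
    interval this is the primitive that vanishes at both ends. *)
Definition interval_primitive a b h (t : R) : R :=
  \1_`]a, b[%classic t * \int[leb1]_s (\1_`]-oo, t[%classic s * h s).

Lemma interval_primitive_le a b h t : a < b -> square_integrable leb1 setT h ->
  (forall t, ~~ (a < t < b) -> h t = 0) ->
  interval_primitive a b h t ^+ 2 <=
    \1_`]a, b[%classic t * ((b - a) * \int[leb1]_s (h s ^+ 2)).
Proof.
move=> ab sh h0; rewrite /interval_primitive exprMn indicE.
case: (t \in _); last by rewrite expr0n !mul0r.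
rewrite expr1n !mul1r.
have sk : square_integrable leb1 setT (fun s => \1_`]-oo, t[%classic s * h s).
  apply: (le_square_integrable measurableT _ (square_integrable_sqr sh)).
  - apply: measurable_funM; first exact: measurable_indic.
    exact: sh.1.
  - move=> s _; rewrite indicE exprMn.
    by case: (s \in _); rewrite ?expr1n ?mul1r// expr0n mul0r sqr_ge0.
have [|_] := square_Rintegral_le ab sk.
  by move=> s /h0 ->; rewrite mulr0.
move/le_trans; apply; rewrite ler_pM2l ?subr_gt0//.
apply: le_Rintegral => //.
- exact: square_integrable_sqr sk.
- exact: square_integrable_sqr sh.
- move=> s _; rewrite indicE exprMn.
  by case: (s \in _); rewrite ?expr1n ?mul1r// expr0n mul0r sqr_ge0.
Qed.

Lemma integral_derive_itv psi psi' s b : s < b ->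
  (forall t, derivable psi t 1) -> (forall t, derive1 psi t = psi' t) ->
  continuous psi' ->
  \int[leb1]_(t in `]s, b[) psi' t = psi b - psi s.
Proof.
move=> sb dpsi psi'E cpsi'.
have cpsi : continuous psi.
  by move=> t; apply: differentiable_continuous; apply/derivable1_diffP.
have i1 : leb1.-integrable `[s, b] (EFin \o psi').
  apply: continuous_compact_integrable; first exact: segment_compact.
  exact: continuous_subspaceT.
have FTC : (\int[leb1]_(t in `[s, b]) (psi' t)%:E = (psi b)%:E - (psi s)%:E)%E.
  apply: continuous_FTC2 => //.
    exact: continuous_subspaceT.
  split => //.
    by apply: cvg_at_right_filter; exact: cpsi.
  by apply: cvg_at_left_filter; exact: cpsi.
rewrite Rintegral_itv_obnd_cbnd; last first.
  by apply: integrableS i1 => // t; rewrite /= !in_itv/= => /andP[/ltW-> /ltW->].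
rewrite Rintegral_itv_bndo_bndc; last first.
  by apply: integrableS i1 => // t; rewrite /= !in_itv/= => /andP[-> /ltW->].
by rewrite /Rintegral FTC.
Qed.

(** Exchanging the two integrals on the left
    leaves the integral over [s] of [h s * (psi b - psi s)], from which the term
    with [psi b] drops out because [h] has mean zero. *)
Lemma interval_primitive_by_parts a b M h psi psi' : a < b ->
  leb1.-integrable setT (EFin \o h) ->
  (forall t, ~~ (a < t < b) -> h t = 0) -> \int[leb1]_t h t = 0 ->
  (forall t, derivable psi t 1) -> (forall t, derive1 psi t = psi' t) ->
  continuous psi' -> (forall t, `|psi t| <= M) -> (forall t, `|psi' t| <= M) ->
  \int[leb1]_t (interval_primitive a b h t * psi' t) =
  - \int[leb1]_t (h t * psi t).
Proof.
move=> ab hi h0 h_mean0 dpsi psi'E cpsi' bpsi bpsi'.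
have mh : measurable_fun setT h by apply/measurable_EFinP; exact: measurable_int hi.
have M0 : 0 <= M by apply: le_trans (bpsi 0).
pose F (z : measurableTypeR R * measurableTypeR R) : R :=
  \1_`]-oo, z.2[%classic z.1 *
  (h z.1 * (\1_`]a, b[%classic z.2 * psi' z.2)).
have mF : measurable_fun setT F.
  apply: measurable_funM.
    exact: measurable_indic_lt.
  apply: measurable_funM; first exact: measurableT_comp.
  apply: measurable_funM.
    by apply: (measurableT_comp _ measurable_snd); exact: measurable_indic.
  apply: (measurableT_comp _ measurable_snd); exact: continuous_measurable_fun.
have chi : leb1.-integrable setT (EFin \o (fun t => M * \1_`]a, b[%classic t)).
  by apply: integrableZ_real => //; exact: integrable_indic_itv.
have iF : (leb1 \x leb1)%E.-integrable setT (EFin \o F).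
  apply: (integrable_prod_le mF hi chi) => s t.
  rewrite /F/= !normrM !indicE.
  rewrite [X in _ <= _ * (X * _)](ger0_norm M0).
  case: (_ \in _); rewrite ?normr1 ?normr0 ?mul1r ?mul0r.
    apply: ler_wpM2l => //; case: (_ \in _); rewrite ?normr1 ?normr0 ?mul1r ?mul0r ?mulr1 ?mulr0//.
  by rewrite !mulr_ge0.
have [_ E1] := Rfubini1 iF; have [_ E2] := Rfubini2 iF.
transitivity (\int[leb1]_t \int[leb1]_s F (s, t)).
  apply: eq_Rintegral => t _; rewrite /interval_primitive.
  rewrite mulrC mulrA -RintegralZl//; last exact: integrable_indicM.
  apply: eq_Rintegral => s _; rewrite /F /= !indicE.
  by ring.
rewrite E2 -E1.
have ihpsi : leb1.-integrable setT (EFin \o (fun t => h t * psi t)).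
  have := integrableZ_real measurableT M hi.
  apply: le_integrable => //.
    apply/measurable_EFinP; apply: measurable_funM => //.
    apply: continuous_measurable_fun => t.
    by apply: differentiable_continuous; apply/derivable1_diffP.
  by move=> t _; rewrite /= lee_fin !normrM (ger0_norm M0) mulrC ler_wpM2r.
transitivity (\int[leb1]_s (psi b * h s - h s * psi s)).
  apply: eq_Rintegral => s _.
  have [/andP[as_ sb]|/h0 hs] := boolP (a < s < b); last first.
    rewrite hs mulr0 mul0r subr0 /F/=.
    under eq_Rintegral do rewrite hs mul0r mulr0.
    by rewrite Rintegral_cst// mul0r.
  transitivity (h s * \int[leb1]_(t in `]s, b[) psi' t).
    rewrite -Rintegral_indic_itv -RintegralZl//; last first.
      apply: (le_integrable measurableT _ _ chi).
        apply/measurable_EFinP; apply: measurable_funM; first exact: measurable_indic.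
        exact: continuous_measurable_fun.
      move=> t _; rewrite /= lee_fin !normrM !indicE.
      have [|_] := boolP (t \in `]s, b[%classic); last by rewrite normr0 mul0r mulr_ge0.
      rewrite inE/= in_itv/= => /andP[st tb].
      rewrite mem_set/=; last by rewrite in_itv/= tb (lt_trans as_ st).
      by rewrite mulrC (ger0_norm M0) ler_wpM2r.
    apply: eq_Rintegral => t _; rewrite /F/= !indicE.
    rewrite mulrCA; congr (_ * _); rewrite mulrA -natrM mulnb; congr (_%:R * _).
    congr nat_of_bool.
    apply/andP/idP; rewrite !inE/= !in_itv/=.
      by move=> [-> /andP[_ ->]].
    by move=> /andP[st ->]; rewrite st (lt_trans as_ st).
  by rewrite (integral_derive_itv sb dpsi psi'E cpsi'); ring.
rewrite RintegralB//; last exact: integrableZ_real.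
by rewrite RintegralZl// h_mean0 mulr0 sub0r.
Qed.

End interval_primitive.

(** The next two bounds are stated in the extended reals because they then
    hold for every measurable [h]: when [h] is not square integrable the right
    side is infinite. They can thus be integrated over all slices of a function
    of several variables, including the exceptional ones. *)
Section interval_square_bounds.
Context {R : realType}.
Notation leb1 := (@lebesgue_measure R).
Variables (a b : R) (h : R -> R).
Hypotheses (ab : a < b) (mh : measurable_fun setT (h : measurableTypeR R -> R)).
Hypothesis h0 : forall t, ~~ (a < t < b) -> h t = 0.

Lemma sqr_Rintegral_le : (((\int[leb1]_t h t) ^+ 2)%:E <=
  (b - a)%:E * \int[leb1]_t (h t ^+ 2)%:E)%E.
Proof.
have ba : 0 < b - a by rewrite subr_gt0.
have [hoo|hoo] := ltP (\int[leb1]_t (h t ^+ 2)%:E)%E +oo%E; last first.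
  by move: hoo; rewrite leye_eq => /eqP ->; rewrite gt0_muley ?lte_fin// leey.
have sh : square_integrable leb1 setT h by [].
by rewrite (square_integrable_EFin sh) -EFinM lee_fin; have [] := square_Rintegral_le ab sh h0.
Qed.

Lemma interval_primitive_sqr_le :
  (\int[leb1]_t (interval_primitive a b h t ^+ 2)%:E <=
   ((b - a) ^+ 2)%:E * \int[leb1]_t (h t ^+ 2)%:E)%E.
Proof.
have ba : 0 < b - a by rewrite subr_gt0.
have [hoo|hoo] := ltP (\int[leb1]_t (h t ^+ 2)%:E)%E +oo%E; last first.
  by move: hoo; rewrite leye_eq => /eqP ->;
    rewrite gt0_muley ?lte_fin ?exprn_gt0// leey.
have sh : square_integrable leb1 setT h by [].
rewrite (square_integrable_EFin sh).
set I := \int[leb1]_t (h t ^+ 2).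
apply: (@le_trans _ _ (\int[leb1]_t (\1_`]a, b[%classic t * ((b - a) * I))%:E)%E).
  apply: ge0_le_integral => //.
  - by move=> t _; rewrite lee_fin sqr_ge0.
  - apply/measurable_EFinP; apply: measurable_funX.
    apply: measurable_funM; first exact: measurable_indic.
    apply: (@measurable_Rintegral_param _ _ _ _ R leb1
      (fun z : measurableTypeR R * measurableTypeR R =>
        \1_`]-oo, z.1[%classic z.2 * h z.2)).
    apply: measurable_funM; last exact: measurableT_comp.
    exact: measurable_indic_lt.
  - apply/measurable_EFinP; apply: measurable_funM => //; exact: measurable_indic.
  - by move=> t _; rewrite lee_fin; exact: interval_primitive_le.
under eq_integral do rewrite EFinM.
rewrite ge0_integralZr//.
- rewrite integral_indic// setIT.
  have E : lebesgue_measure (`]a, b[%classic : set R) = (b - a)%:E.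
    by rewrite lebesgue_measure_itv/= lte_fin ab.
  rewrite [X in (X * _ <= _)%E](E : _ = _).
  by rewrite -!EFinM lee_fin expr2 mulrA.
- by apply/measurable_EFinP; exact: measurable_indic.
- have I0 : 0 <= I by apply: Rintegral_ge0 => t _; exact: sqr_ge0.
  by rewrite lee_fin mulr_ge0// ltW.
Qed.

End interval_square_bounds.

(** * Flow along one coordinate *)

(** One step of the construction of a field with a given divergence [g],
    supported in the product of [S] and an interval. The part of [g] that has
    mean zero on each slice is the derivative of a function of the last variable
    that vanishes at both ends, namely [slice_flow]. What remains is the function
    [slice_mean] of the other variables, to which the construction is applied
    again. *)
Section slice_step.
Context d (X : measurableType d) (R : realType).
Variable mu : {sigma_finite_measure set X -> \bar R}.
Notation leb1 := (@lebesgue_measure R).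
Notation mul := (mu \x leb1)%E.
Variables (a b : R) (S : set X).
Hypotheses (ab : a < b) (mS : measurable S) (muS : (mu S < +oo)%E).
Variable g : X * measurableTypeR R -> R.
Hypothesis sg : square_integrable mul setT g.
Hypothesis g_supp : forall y t, ~ (S y /\ a < t < b) -> g (y, t) = 0.

Let I : set (measurableTypeR R) := `]a, b[%classic.

Let mI : measurable I. Proof. exact: measurable_itv. Qed.

Let lebI : leb1 I = (b - a)%:E.
Proof.
have E : lebesgue_measure (`]a, b[%classic : set R) = (b - a)%:E.
  by rewrite lebesgue_measure_itv/= lte_fin ab.
exact: E.
Qed.

Let ba : 0 < b - a. Proof. by rewrite subr_gt0. Qed.

Lemma slab_lty : (mul (S `*` I) < +oo)%E.
Proof.
by rewrite product_measure1E// [X in (_ * X)%E](lebI : _ = _) lte_mul_pinfty// ?ltry// ge0_fin_numE.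
Qed.

Let mSI : measurable (S `*` I). Proof. exact: measurableX. Qed.

Lemma slab_integrable (f : X * measurableTypeR R -> R) :
  square_integrable mul setT f ->
  (forall y t, ~ (S y /\ a < t < b) -> f (y, t) = 0) ->
  mul.-integrable setT (EFin \o f).
Proof.
move=> sf f_supp.
apply: (square_integrable_integrable mSI slab_lty) sf => -[y t] nSI.
by apply: f_supp => -[Sy tab]; apply: nSI; split => //=; rewrite in_itv.
Qed.

Definition slice_mean (y : X) : R := (b - a)^-1 * \int[leb1]_t g (y, t).

Definition slice_residual (z : X * measurableTypeR R) : R :=
  g z - \1_I z.2 * slice_mean z.1.

Definition slice_flow (z : X * measurableTypeR R) : R :=
  interval_primitive a b (fun t => slice_residual (z.1, t)) z.2.

Let mg : measurable_fun setT g. Proof. exact: sg.1. Qed.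

Lemma measurable_slice_mean : measurable_fun setT slice_mean.
Proof.
apply: measurable_funM => //; exact: (measurable_Rintegral_param leb1 mg).
Qed.

Lemma measurable_slice_residual : measurable_fun setT slice_residual.
Proof.
apply: measurable_funB => //; apply: measurable_funM.
  by apply: (measurableT_comp _ measurable_snd); exact: measurable_indic.
exact: (measurableT_comp measurable_slice_mean measurable_fst).
Qed.

Lemma measurable_slice_flow : measurable_fun setT slice_flow.
Proof.
apply: measurable_funM.
  by apply: (measurableT_comp _ measurable_snd); exact: measurable_indic.
apply: (@measurable_Rintegral_param _ _ _ _ R leb1
  (fun zs : (X * measurableTypeR R) * measurableTypeR R =>
     \1_`]-oo, zs.1.2[%classic zs.2 * slice_residual (zs.1.1, zs.2))).
apply: measurable_funM; last first.
  apply: (measurableT_comp measurable_slice_residual).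
  apply/measurable_fun_pairP; split; last exact: measurable_snd.
  exact: (measurableT_comp measurable_fst measurable_fst).
apply: measurable_indic_lt; first exact: measurable_snd.
exact: (measurableT_comp measurable_snd measurable_fst).
Qed.

Lemma slice_mean_supp y : ~ S y -> slice_mean y = 0.
Proof.
move=> nSy; rewrite /slice_mean.
under eq_Rintegral do (rewrite g_supp; last by case=> /nSy).
by rewrite Rintegral_cst// mul0r mulr0.
Qed.

Lemma slice_residual_supp y t : ~ (S y /\ a < t < b) -> slice_residual (y, t) = 0.
Proof.
move=> nSI; rewrite /slice_residual/= g_supp// sub0r indicE.
have [Sy|/slice_mean_supp ->] := pselect (S y); last by rewrite mulr0 oppr0.
rewrite memNset ?mul0r ?oppr0// /I/= in_itv/= => tab.
exact: nSI.
Qed.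

Lemma slice_flow_supp y t : ~ (S y /\ a < t < b) -> slice_flow (y, t) = 0.
Proof.
move=> nSI; rewrite /slice_flow /interval_primitive/= indicE.
have [Sy|nSy] := pselect (S y); last first.
  under eq_Rintegral do (rewrite slice_residual_supp ?mulr0; last by case=> /nSy).
  by rewrite Rintegral_cst// mul0r mulr0.
rewrite memNset ?mul0r// /= in_itv/= => tab.
exact: nSI.
Qed.

Let G := \int[mul]_z (g z ^+ 2).

Let integral_sqr (f : X * measurableTypeR R -> R) : measurable_fun setT f ->
  (\int[mul]_z (f z ^+ 2)%:E = \int[mu]_y \int[leb1]_t (f (y, t) ^+ 2)%:E)%E.
Proof.
move=> mf.
rewrite (@fubini_tonelli1 _ _ _ _ _ mu leb1 (fun z => (f z ^+ 2)%:E))//.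
  by apply/measurable_EFinP; exact: measurable_funX.
by move=> z; rewrite lee_fin sqr_ge0.
Qed.

Let measurable_slice_sqr (f : X * measurableTypeR R -> R) : measurable_fun setT f ->
  measurable_fun setT (fun y => \int[leb1]_t (f (y, t) ^+ 2)%:E)%E.
Proof.
move=> mf.
apply: (@measurable_fun_fubini_tonelli_F _ _ _ _ _ leb1 (fun z => (f z ^+ 2)%:E)).
  by apply/measurable_EFinP; exact: measurable_funX.
by move=> z; rewrite lee_fin sqr_ge0.
Qed.

Lemma square_integrable_slice_mean :
  square_integrable mu setT slice_mean /\
  (b - a) * \int[mu]_y (slice_mean y ^+ 2) <= G.
Proof.
rewrite -ler_pdivlMl// mulrC.
apply: square_integrable_le; first exact: measurable_slice_mean.
rewrite mulrC EFinM -square_integrable_EFin// integral_sqr//.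
rewrite -ge0_integralZl//; last 3 first.
- exact: measurable_slice_sqr.
- by move=> y _; apply: integral_ge0 => t _; rewrite lee_fin sqr_ge0.
- by rewrite lee_fin invr_ge0 ltW.
apply: ge0_le_integral => //.
- by move=> y _; rewrite lee_fin sqr_ge0.
- apply/measurable_EFinP; apply: measurable_funX; exact: measurable_slice_mean.
- by apply: measurable_funeM; exact: measurable_slice_sqr.
move=> y _; rewrite /slice_mean exprMn EFinM.
have H := @sqr_Rintegral_le R a b (fun t => g (y, t)) ab
  (measurableT_comp mg (pair1_measurable y))
  (fun t tab => g_supp (fun Syt => negP tab Syt.2)).
apply: (@le_trans _ _ (((b - a)^-1 ^+ 2)%:E *
  ((b - a)%:E * \int[leb1]_t (g (y, t) ^+ 2)%:E))%E).
  by apply: lee_wpmul2l => //; rewrite lee_fin sqr_ge0.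
rewrite muleA -EFinM; suff -> : (b - a)^-1 ^+ 2 * (b - a) = (b - a)^-1 by [].
by field; rewrite gt_eqF.
Qed.

Lemma integral_slice_mean : mu.-integrable setT (EFin \o slice_mean) /\
  \int[mu]_y slice_mean y = (b - a)^-1 * \int[mul]_z g z.
Proof.
have [ig E] := Rfubini1 (slab_integrable sg g_supp).
split; first exact: integrableZ_real.
by rewrite RintegralZl// E.
Qed.

Lemma square_integrable_slab (f : X -> R) : square_integrable mu setT f ->
  square_integrable mul setT (fun z => \1_I z.2 * f z.1) /\
  \int[mul]_z ((\1_I z.2 * f z.1) ^+ 2) = (b - a) * \int[mu]_y (f y ^+ 2).
Proof.
move=> sf.
have mF : measurable_fun [set: X * measurableTypeR R] (fun z => \1_I z.2 * f z.1).
  apply: measurable_funM.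
    by apply: (measurableT_comp _ measurable_snd); exact: measurable_indic.
  exact: (measurableT_comp sf.1 measurable_fst).
have E : (\int[mul]_z ((\1_I z.2 * f z.1) ^+ 2)%:E =
    ((b - a) * \int[mu]_y (f y ^+ 2))%:E)%E.
  rewrite integral_sqr//= EFinM -square_integrable_EFin// -ge0_integralZl//.
  - apply: eq_integral => y _.
    transitivity (\int[leb1]_t ((\1_I t)%:E * (f y ^+ 2)%:E))%E.
      apply: eq_integral => t _; rewrite -EFinM exprMn indicE.
      by case: (_ \in _); rewrite ?expr1n ?expr0n.
    rewrite ge0_integralZr//; last 2 first.
      by apply/measurable_EFinP; exact: measurable_indic.
      by rewrite lee_fin sqr_ge0.
    rewrite integral_indic// setIT.
    by rewrite [X in (X * _)%E](lebI : _ = _).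
  - by apply/measurable_EFinP; apply: measurable_funX; exact: sf.1.
  - by move=> y _; rewrite lee_fin sqr_ge0.
  - by rewrite lee_fin ltW.
split; last by rewrite /Rintegral E.
by split => //; rewrite E ltry.
Qed.

Lemma square_integrable_slice_residual :
  square_integrable mul setT slice_residual /\
  \int[mul]_z (slice_residual z ^+ 2) <= 4 * G.
Proof.
have [sm mG] := square_integrable_slice_mean.
have [s1 E1] := square_integrable_slab sm.
have sr : square_integrable mul setT slice_residual by exact: square_integrableB.
split => //.
have i1 := square_integrable_sqr s1; have ig := square_integrable_sqr sg.
apply: (@le_trans _ _ (\int[mul]_z
    (2 * (g z ^+ 2 + (\1_I z.2 * slice_mean z.1) ^+ 2)))).
  apply: le_Rintegral => //.
  - exact: square_integrable_sqr sr.
  - by apply: integrableZ_real => //; exact: integrableD_real.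
  - move=> z _; rewrite /slice_residual.
    set u := g z; set v := _ * slice_mean _.
    by have := sqr_ge0 (u + v); nra.
rewrite RintegralZl//; last exact: integrableD_real.
rewrite RintegralD// E1 -/G; lra.
Qed.

Lemma square_integrable_slice_flow :
  square_integrable mul setT slice_flow /\
  \int[mul]_z (slice_flow z ^+ 2) <= 4 * (b - a) ^+ 2 * G.
Proof.
have [sr rG] := square_integrable_slice_residual.
apply: square_integrable_le; first exact: measurable_slice_flow.
rewrite integral_sqr; last exact: measurable_slice_flow.
apply: (@le_trans _ _ (((b - a) ^+ 2)%:E * (\int[mul]_z (slice_residual z ^+ 2))%:E)%E);
  last first.
  by rewrite -EFinM lee_fin; have := sqr_ge0 (b - a); nra.
rewrite -square_integrable_EFin// integral_sqr; last exact: sr.1.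
rewrite -ge0_integralZl//; last 3 first.
- by apply: measurable_slice_sqr; exact: sr.1.
- by move=> y _; apply: integral_ge0 => t _; rewrite lee_fin sqr_ge0.
- by rewrite lee_fin sqr_ge0.
apply: ge0_le_integral => //.
- by move=> y _; apply: integral_ge0 => t _; rewrite lee_fin sqr_ge0.
- by apply: measurable_slice_sqr; exact: measurable_slice_flow.
- by apply: measurable_funeM; apply: measurable_slice_sqr; exact: sr.1.
move=> y _; rewrite /slice_flow/=.
exact: (@interval_primitive_sqr_le R a b (fun t => slice_residual (y, t)) ab
  (measurableT_comp sr.1 (pair1_measurable y))
  (fun t tab => slice_residual_supp (fun Syt => negP tab Syt.2))).
Qed.

(** Integration by parts on almost every slice: those where [g] and
    [slice_residual] are integrable. *)
Lemma slice_flow_by_parts (psi psi' : X * measurableTypeR R -> R) (M : R) :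
  measurable_fun setT psi -> measurable_fun setT psi' ->
  (forall z, `|psi z| <= M) -> (forall z, `|psi' z| <= M) ->
  (forall y (t : R), derivable (fun t : R => psi (y, t)) t 1) ->
  (forall y (t : R), derive1 (fun t : R => psi (y, t)) t = psi' (y, t)) ->
  (forall y, continuous (fun t : R => psi' (y, t))) ->
  \int[mul]_z (slice_flow z * psi' z) =
  \int[mul]_z ((\1_I z.2 * slice_mean z.1) * psi z)
  - \int[mul]_z (g z * psi z).
Proof.
move=> mpsi mpsi' bpsi bpsi' dpsi psi'E cpsi'.
have [sr _] := square_integrable_slice_residual.
have [sf _] := square_integrable_slice_flow.
have [sm _] := square_integrable_slice_mean.
have ig : mul.-integrable setT (EFin \o g) := slab_integrable sg g_supp.
have ir : mul.-integrable setT (EFin \o slice_residual).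
  exact: slab_integrable sr slice_residual_supp.
have iw : mul.-integrable setT (EFin \o slice_flow).
  exact: slab_integrable sf slice_flow_supp.
have im : mul.-integrable setT (EFin \o (fun z => \1_I z.2 * slice_mean z.1)).
  apply: slab_integrable => [|y t nSI /=].
    by have [] := square_integrable_slab sm.
  have [Sy|/slice_mean_supp ->] := pselect (S y); last by rewrite mulr0.
  rewrite indicE memNset ?mul0r// /I/= in_itv/= => tab; exact: nSI.
transitivity (- \int[mul]_z (slice_residual z * psi z)); last first.
  have -> : \int[mul]_z (slice_residual z * psi z) =
    \int[mul]_z (g z * psi z - (\1_I z.2 * slice_mean z.1) * psi z).
    by apply: eq_Rintegral => z _; rewrite /slice_residual; ring.
  rewrite RintegralB//; [|exact: (integrableM_bounded bpsi)..].
  by rewrite opprB.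
have iwp := integrableM_bounded bpsi' mpsi' iw.
have irp := integrableM_bounded bpsi mpsi ir.
have [i1 <-] := Rfubini1 iwp; have [i2 <-] := Rfubini1 irp.
transitivity (\int[mu]_y (-1 * \int[leb1]_t (slice_residual (y, t) * psi (y, t))));
  last by rewrite RintegralZl// mulN1r.
apply: ae_eq_Rintegral => //; first exact: integrableZ_real.
have := ae_integrable1 ir; have := ae_integrable1 ig; apply: filterS2 => y igy iry _.
rewrite mulN1r.
apply: (@interval_primitive_by_parts R a b M (fun t => slice_residual (y, t))) => //.
  by move=> t tab; apply: slice_residual_supp => -[_]; exact/negP.
rewrite /slice_residual/= RintegralB//; last first.
  under eq_fun do rewrite mulrC.
  by apply: integrableZ_real => //; exact: integrable_indic_itv.
under [X in _ - X]eq_Rintegral do rewrite mulrC.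
rewrite RintegralZl//; last exact: integrable_indic_itv.
have -> : \int[leb1]_t \1_I t = b - a.
  rewrite /Rintegral integral_indic// setIT; exact: (congr1 fine lebI).
rewrite /slice_mean mulrAC mulVf ?mul1r ?subrr// gt_eqF//.
Qed.

End slice_step.

(** * Splitting off the first coordinate *)

Section leb_successor.
Context {R : realType} (n : nat).
Notation leb1 := (@lebesgue_measure R).
Notation mul := (@lebS R n \x leb1)%E.
Implicit Types f : 'rV[R]_n.+1 -> R.

Lemma measurable_consP f :
  measurable_fun setT (f \o @rV_cons R n) -> measurable_fun setT f.
Proof.
move=> mf; rewrite (_ : f = (f \o @rV_cons R n) \o @rV_uncons R n).
  exact: (measurableT_comp mf (@measurable_rV_uncons R n)).
by apply/funext => x /=; rewrite rV_unconsK.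
Qed.

Lemma Rintegral_leb_succ f :
  mul.-integrable setT (EFin \o (f \o @rV_cons R n)) ->
  (leb R n.+1).-integrable setT (EFin \o f) /\
  \int[leb R n.+1]_x f x = \int[mul]_z f (rV_cons z).
Proof.
move=> fi.
have mf : measurable_fun setT (EFin \o f).
  apply/measurable_EFinP; apply: measurable_consP; apply/measurable_EFinP.
  exact: measurable_int fi.
have fi' : mul.-integrable (@rV_cons R n @^-1` setT)
  ((EFin \o f) \o @rV_cons R n) by [].
split.
  exact: (integrable_pushforward (@measurable_rV_cons R n) mf fi').
by congr fine; exact: (integral_pushforward (@measurable_rV_cons R n) mf fi').
Qed.

Lemma square_integrable_leb_succ f :
  square_integrable mul setT (f \o @rV_cons R n) ->
  square_integrable (leb R n.+1) setT f /\
  \int[leb R n.+1]_x (f x ^+ 2) = \int[mul]_z (f (rV_cons z) ^+ 2).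
Proof.
move=> sf; have mf := measurable_consP sf.1.
have [i E] := @Rintegral_leb_succ (fun x => f x ^+ 2) (square_integrable_sqr sf).
by split => //; exact: (le_square_integrable measurableT mf i).
Qed.

Lemma square_integrable_cons f : square_integrable (leb R n.+1) setT f ->
  square_integrable mul setT (f \o @rV_cons R n).
Proof.
move=> [mf fi]; split.
  exact: (measurableT_comp mf (@measurable_rV_cons R n)).
move: fi; rewrite [X in (X < _)%E -> _](ge0_integral_pushforward
  (@measurable_rV_cons R n) (product_measure1 (leb R n) leb1))//.
  by apply/measurable_EFinP; exact: measurable_funX.
by move=> x _; rewrite lee_fin sqr_ge0.
Qed.

End leb_successor.

Section bounded_C1.
Context {R : realType}.

(** Unlike the class of test functions on a domain, this class is stable under
    freezing one coordinate, with the same bound [M]. *)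
Definition bounded_C1 n (M : R) (phi : 'rV[R]_n -> R) : Prop :=
  [/\ continuous phi, forall l x, derivable phi x (delta_mx 0 l),
      forall l, continuous (partial l phi),
      forall x, `|phi x| <= M & forall l x, `|partial l phi x| <= M].

Lemma rV_cons_addl n (y : 'rV[R]_n) (t h : R) :
  rV_cons (y, h + t) = h *: delta_mx 0 ord0 + rV_cons (y, t).
Proof.
apply/rowP => k; rewrite !mxE; case: unliftP => [j ->|->] /=.
  by rewrite mulr0 add0r.
by rewrite mulr1.
Qed.

Lemma rV_cons_addr n (y : 'rV[R]_n) (t h : R) j :
  rV_cons (h *: delta_mx 0 j + y, t) =
  h *: delta_mx 0 (lift ord0 j) + rV_cons (y, t).
Proof.
apply/rowP => k; rewrite !mxE; case: unliftP => [i ->|->] /=.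
  by rewrite !mxE (inj_eq (@lift_inj _ ord0)).
by rewrite mulr0 add0r.
Qed.

Lemma continuous_rV_cons_snd n (y : 'rV[R]_n) :
  continuous (fun t : R => rV_cons (y, t)).
Proof.
move=> t; apply/cvg_ballP => e e0.
have : \forall s \near t, ball t e s by exact: nbhsx_ballx.
apply: filterS => s ts; split => // i k.
rewrite !mxE; case: unliftP => [j _|_] /=; first exact: ballxx.
exact: ts.
Qed.

Lemma continuous_rV_cons_fst n (t : R) :
  continuous (fun y : 'rV[R]_n => rV_cons (y, t)).
Proof.
move=> y A /nbhs_ballP[e e0 eA]; apply/nbhs_ballP; exists e => // z yz.
apply: eA; split => // i k.
rewrite !mxE; case: unliftP => [j _|_] /=; last exact: ballxx.
by case: yz => _; exact.
Qed.

Variables (n : nat) (M : R) (phi : 'rV[R]_n.+1 -> R).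
Hypothesis C1phi : bounded_C1 M phi.

Lemma derivable_slice_snd (y : 'rV[R]_n) (t : R) :
  derivable (fun t : R => phi (rV_cons (y, t))) t 1 /\
  derive1 (fun t : R => phi (rV_cons (y, t))) t = partial ord0 phi (rV_cons (y, t)).
Proof.
have [_ dphi _ _ _] := C1phi.
have E : (fun h : R => h^-1 *: (phi (rV_cons (y, h *: 1 + t)) - phi (rV_cons (y, t))))
  = (fun h : R => h^-1 *: (phi (h *: delta_mx 0 ord0 + rV_cons (y, t))
                          - phi (rV_cons (y, t)))).
  by apply/funext => h; rewrite -rV_cons_addl /GRing.scale/= mulr1.
split.
  by rewrite /derivable E; exact: dphi.
by rewrite derive1E /partial /derive E.
Qed.

Lemma bounded_C1_slice_fst (t : R) :
  bounded_C1 M (fun y : 'rV[R]_n => phi (rV_cons (y, t))) /\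
  forall j (y : 'rV[R]_n), partial j (fun y => phi (rV_cons (y, t))) y =
    partial (lift ord0 j) phi (rV_cons (y, t)).
Proof.
have [cphi dphi cdphi bphi bdphi] := C1phi.
have E j (y : 'rV[R]_n) : (fun h : R => h^-1 *:
      (phi (rV_cons (h *: delta_mx 0 j + y, t)) - phi (rV_cons (y, t))))
  = (fun h : R => h^-1 *: (phi (h *: delta_mx 0 (lift ord0 j) + rV_cons (y, t))
                          - phi (rV_cons (y, t)))).
  by apply/funext => h; rewrite -rV_cons_addr.
have dE j (y : 'rV[R]_n) : partial j (fun y => phi (rV_cons (y, t))) y =
    partial (lift ord0 j) phi (rV_cons (y, t)).
  by rewrite /partial /derive E.
split => //; split.
- move=> y; apply: continuous_comp; first exact: continuous_rV_cons_fst.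
  exact: cphi.
- by move=> j y; rewrite /derivable E; exact: dphi.
- move=> j; rewrite (funext (dE j)) => y.
  apply: continuous_comp; first exact: continuous_rV_cons_fst.
  exact: cdphi.
- by move=> y; exact: bphi.
- by move=> j y; rewrite dE; exact: bdphi.
Qed.

End bounded_C1.

(** * A right inverse of the divergence on a brick *)

Section brick_divergence.
Context {R : realType}.
Notation leb1 := (@lebesgue_measure R).

Lemma square_integrable_brick n (T : 'rV[R]_n * 'rV[R]_n) (f : 'rV[R]_n -> R) :
  square_integrable (leb R n) setT f ->
  (forall x, ~ obrick T x -> f x = 0) ->
  (leb R n).-integrable setT (EFin \o f).
Proof.
move=> sf fT; apply: (square_integrable_integrable (measurable_obrick T)) fT sf.
exact: leb_obrick_lty.
Qed.

(** A right inverse of the divergence on a brick, for data of mean zero, with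
    zero normal component on the boundary. The boundary condition is encoded by
    testing against functions that need not vanish there: [v], extended by zero,
    has divergence [g] on the whole space. By induction on the dimension, the
    first component is the slice flow of [g], and the others are given by the
    induction hypothesis for the slice mean of [g], extended as constants in the
    first variable. Averaging divides the square of the norm by the length of
    the edge and this extension multiplies it back, so each dimension adds the
    same amount to the constant. *)
Lemma brick_divergence n (T : 'rV[R]_n * 'rV[R]_n) (L : R) (g : 'rV[R]_n -> R) :
  (forall l, T.1 0 l < T.2 0 l) -> (forall l, T.2 0 l - T.1 0 l <= L) ->
  square_integrable (leb R n) setT g ->
  (forall x, ~ obrick T x -> g x = 0) ->
  \int[leb R n]_x g x = 0 ->
  exists v : 'rV[R]_n -> 'rV[R]_n,
  [/\ forall l, square_integrable (leb R n) setT (fun x => v x 0 l),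
      forall x, ~ obrick T x -> v x = 0,
      \sum_l \int[leb R n]_x (v x 0 l ^+ 2) <=
        4 * n%:R * L ^+ 2 * \int[leb R n]_x (g x ^+ 2) &
      forall M phi, bounded_C1 M phi ->
        \sum_l \int[leb R n]_x (v x 0 l * partial l phi x) =
        - \int[leb R n]_x (g x * phi x)].
Proof.
elim: n T g => [|n ih] T g Tlt TL sg g_supp g_mean.
  (* The measure is a Dirac mass, so mean zero forces [g] to vanish. *)
  exists (fun _ => 0); split.
  - by case.
  - by [].
  - by rewrite big_ord0 mulr0 !mul0r.
  - have g0 x : g x = 0.
      rewrite (_ : x = 0); last by apply/rowP; case.
      move: g_mean; rewrite /Rintegral /= integral_dirac//.
        by rewrite diracT mul1e.
      by apply/measurable_EFinP; exact: sg.1.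
    move=> M phi _; rewrite big_ord0.
    under eq_Rintegral do rewrite g0 mul0r.
    by rewrite Rintegral_cst// mul0r oppr0.
pose T' := ((rV_uncons T.1).1, (rV_uncons T.2).1).
pose a := T.1 0 ord0; pose b := T.2 0 ord0.
have ab : a < b by exact: Tlt.
have ba : 0 < b - a by rewrite subr_gt0.
have baL : b - a <= L by exact: TL.
have L0 : 0 <= L := le_trans (ltW ba) baL.
pose mu := @lebS R n.
pose G : 'rV[R]_n * measurableTypeR R -> R := g \o @rV_cons R n.
have sG : square_integrable (mu \x leb1)%E setT G := square_integrable_cons sg.
have mT' := measurable_obrick T'.
have lT' : (mu (obrick T') < +oo)%E := leb_obrick_lty T'.
have G_supp y t : ~ (obrick T' y /\ a < t < b) -> G (y, t) = 0.
  by move=> nT; apply: g_supp => /obrick_cons.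
have iG := slab_integrable ab mT' lT' sG G_supp.
have [_ gE] := Rintegral_leb_succ iG.
have [sm mG] := square_integrable_slice_mean ab sG G_supp.
have [im mE] := integral_slice_mean ab mT' lT' sG G_supp.
pose m := slice_mean a b G.
have [|||||v' [sv' v'_supp v'_le v'_div]] := ih T' m.
- by move=> l; rewrite !mxE; exact: Tlt.
- by move=> l; rewrite !mxE; exact: TL.
- exact: sm.
- by move=> y; exact: (slice_mean_supp G_supp).
- by rewrite [LHS]mE -[X in _ * X]gE g_mean mulr0.
pose w := slice_flow a b G.
have [sw wG] := square_integrable_slice_flow ab sG G_supp.
pose I : set (measurableTypeR R) := `]a, b[%classic.
pose V (p : 'rV[R]_n * measurableTypeR R) : 'rV[R]_n.+1 :=
  \row_k if unlift ord0 k is Some j then \1_I p.2 * v' p.1 0 j else w p.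
pose v x := V (rV_uncons x).
have v0 p : v (rV_cons p) 0 ord0 = w p.
  by rewrite /v rV_consK mxE unlift_none.
have vS p j : v (rV_cons p) 0 (lift ord0 j) = \1_I p.2 * v' p.1 0 j.
  by rewrite /v rV_consK mxE liftK.
have v0E : (fun x => v x 0 ord0) \o @rV_cons R n = w by apply/funext => p /=.
have vSE j : (fun x => v x 0 (lift ord0 j)) \o @rV_cons R n =
    (fun p => \1_I p.2 * v' p.1 0 j) by apply/funext => p /=.
have [s0 E0] : square_integrable (leb R n.+1) setT (fun x => v x 0 ord0) /\
    \int[leb R n.+1]_x (v x 0 ord0 ^+ 2) = \int[(mu \x leb1)%E]_p (w p ^+ 2).
  have [|s E] := @square_integrable_leb_succ R n (fun x => v x 0 ord0).
    by rewrite v0E.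
  by split => //; rewrite E; apply: eq_Rintegral => p _; rewrite v0.
have sE j : square_integrable (leb R n.+1) setT (fun x => v x 0 (lift ord0 j)) /\
    \int[leb R n.+1]_x (v x 0 (lift ord0 j) ^+ 2) =
    (b - a) * \int[mu]_y (v' y 0 j ^+ 2).
  have [s1 E1] := square_integrable_slab (mu := mu) ab (sv' j).
  have [|s E] := @square_integrable_leb_succ R n (fun x => v x 0 (lift ord0 j)).
    by rewrite vSE.
  split => //; rewrite E -[RHS]E1; apply: eq_Rintegral => p _.
  by rewrite vS.
have v_supp x : ~ obrick T x -> v x = 0.
  rewrite -(rV_unconsK x); case: (rV_uncons x) => y t nT.
  have nT' : ~ (obrick T' y /\ a < t < b) by move=> ?; apply: nT; apply/obrick_cons.
  apply/rowP => k; rewrite [RHS]mxE.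
  case: (unliftP ord0 k) => [j ->|->].
    rewrite vS /= indicE.
    have [Ty|/v'_supp ->] := pselect (obrick T' y); last by rewrite mxE mulr0.
    by rewrite memNset ?mul0r// /I/= in_itv/= => tab; exact: nT'.
  by rewrite v0; exact: (slice_flow_supp G_supp).
have v_sq l : square_integrable (leb R n.+1) setT (fun x => v x 0 l).
  by case: (unliftP ord0 l) => [j ->|-> //]; have [] := sE j.
exists v; split => //.
- rewrite big_ord_recl E0.
  under eq_bigr do rewrite (sE _).2.
  rewrite -mulr_sumr.
  have gG : \int[leb R n.+1]_x (g x ^+ 2) = \int[(mu \x leb1)%E]_p (G p ^+ 2).
    by have [] := square_integrable_leb_succ sG.
  rewrite gG.
  set N := \int[_]_p (G p ^+ 2) in mG wG *.
  set Q := \int[_]_y (slice_mean a b G y ^+ 2) in mG.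
  have N0 : 0 <= N by apply: Rintegral_ge0 => p _; exact: sqr_ge0.
  have L2 : (b - a) ^+ 2 <= L ^+ 2 by rewrite lerXn2r// nnegrE ltW// (lt_le_trans ba).
  have wL : \int[(mu \x leb1)%E]_p (w p ^+ 2) <= 4 * L ^+ 2 * N.
    by apply: le_trans wG _; rewrite ler_wpM2r// ler_wpM2l.
  have vL : (b - a) * (\sum_j \int[mu]_y (v' y 0 j ^+ 2)) <= 4 * n%:R * L ^+ 2 * N.
    apply: (@le_trans _ _ ((b - a) * (4 * n%:R * L ^+ 2 * Q))).
      by rewrite ler_pM2l//; exact: v'_le.
    rewrite mulrCA ler_wpM2l// !mulr_ge0//.
  apply: le_trans (lerD wL vL) _.
  by rewrite -[n.+1%:R]natr1 le_eqVlt; apply/orP; left; apply/eqP; ring.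
- move=> M phi C1phi.
  have [cphi dphi cdphi bphi bdphi] := C1phi.
  have mphi := continuous_rV_measurable cphi.
  have mdphi l := continuous_rV_measurable (cdphi l).
  pose psi p := phi (rV_cons p : 'rV[R]_n.+1).
  pose psi' p := partial ord0 phi (rV_cons p : 'rV[R]_n.+1).
  have mpsi : measurable_fun setT psi := measurableT_comp mphi (@measurable_rV_cons R n).
  have mpsi' : measurable_fun setT psi' :=
    measurableT_comp (mdphi ord0) (@measurable_rV_cons R n).
  have byparts := @slice_flow_by_parts _ _ _ mu a b _ ab mT' lT' G sG G_supp psi psi' M
    mpsi mpsi' (fun z => bphi _) (fun z => bdphi _ _)
    (fun y t => (derivable_slice_snd C1phi y t).1)
    (fun y t => (derivable_slice_snd C1phi y t).2) _.
  have cpsi' y : continuous (fun t : R => psi' (y, t)).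
    move=> t; exact: (@continuous_comp _ _ _ (fun t : R => rV_cons (y, t))
      (partial ord0 phi) t (@continuous_rV_cons_snd _ _ y t) (cdphi ord0 _)).
  have sw' := slab_integrable ab mT' lT' sw (slice_flow_supp G_supp).
  have iw := integrableM_bounded (fun z => bdphi ord0 (rV_cons z)) mpsi' sw'.
  pose dphi' j p := partial (lift ord0 j) phi (rV_cons p : 'rV[R]_n.+1).
  have mdphi' j : measurable_fun setT (dphi' j) :=
    measurableT_comp (mdphi (lift ord0 j)) (@measurable_rV_cons R n).
  have slab_supp (f : 'rV[R]_n -> R) y t : (forall y, ~ obrick T' y -> f y = 0) ->
      ~ (obrick T' y /\ a < t < b) -> \1_I t * f y = 0.
    move=> fT nT; have [Ty|/fT ->] := pselect (obrick T' y); last by rewrite mulr0.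
    by rewrite indicE memNset ?mul0r// /I/= in_itv/= => tab; exact: nT.
  have islab (f : 'rV[R]_n -> R) : square_integrable mu setT f ->
      (forall y, ~ obrick T' y -> f y = 0) ->
      (mu \x leb1)%E.-integrable setT (EFin \o (fun p => \1_I p.2 * f p.1)).
    move=> sf fT; apply: (slab_integrable ab mT' lT').
      by have [] := square_integrable_slab (mu := mu) ab sf.
    by move=> y t; exact: slab_supp.
  have v'j_supp j y : ~ obrick T' y -> v' y 0 j = 0.
    by move=> /v'_supp ->; rewrite mxE.
  have ivj j := integrableM_bounded (fun z => bdphi (lift ord0 j) (rV_cons z))
    (mdphi' j) (islab _ (sv' j) (v'j_supp j)).
  have m_supp y : ~ obrick T' y -> m y = 0 by exact: (slice_mean_supp G_supp).
  have imp := integrableM_bounded (fun z => bphi (rV_cons z)) mpsi (islab _ sm m_supp).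
  have Ej j : \int[leb R n.+1]_x (v x 0 (lift ord0 j) * partial (lift ord0 j) phi x) =
      \int[leb1]_t \int[mu]_y (\1_I t * v' y 0 j * dphi' j (y, t)).
    have [|_ E] := @Rintegral_leb_succ R n
      (fun x => v x 0 (lift ord0 j) * partial (lift ord0 j) phi x).
      apply: eq_integrable (ivj j) => // p _.
      by rewrite /= vS.
    rewrite E; have [_ E'] := Rfubini2 (ivj j).
    by rewrite [RHS]E'; apply: eq_Rintegral => p _; rewrite vS.
  have E0' : \int[leb R n.+1]_x (v x 0 ord0 * partial ord0 phi x) =
      \int[(mu \x leb1)%E]_p (w p * psi' p).
    have [|_ E] := @Rintegral_leb_succ R n (fun x => v x 0 ord0 * partial ord0 phi x).
      by apply: eq_integrable iw => // p _; rewrite /= v0.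
    by rewrite E; apply: eq_Rintegral => p _; rewrite v0.
  have Eg : \int[leb R n.+1]_x (g x * phi x) = \int[(mu \x leb1)%E]_p (G p * psi p).
    have [|_ E //] := @Rintegral_leb_succ R n (fun x => g x * phi x).
    exact: (integrableM_bounded (fun z => bphi (rV_cons z)) mpsi iG).
  rewrite big_ord_recl E0' (byparts cpsi') Eg.
  under eq_bigr do rewrite Ej.
  rewrite -(Rintegral_sum measurableT); last by move=> j; have [] := Rfubini2 (ivj j).
  suff -> : \int[leb1]_t (\sum_j \int[mu]_y (\1_I t * v' y 0 j * dphi' j (y, t))) =
      \int[leb1]_t (-1 * \int[mu]_y (\1_I t * m y * psi (y, t))).
    have [ii E] := Rfubini2 imp.
    by rewrite RintegralZl// E mulN1r addrAC subrr add0r.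
  apply: eq_Rintegral => t _.
  have [C1t dphiE] := bounded_C1_slice_fst C1phi t.
  have [cphit _ cdphit bphit bdphit] := C1t.
  transitivity (\1_I t * \sum_j \int[mu]_y
      (v' y 0 j * partial j (fun y => phi (rV_cons (y, t))) y)).
    rewrite mulr_sumr; apply: eq_bigr => j _.
    rewrite -RintegralZl//; last first.
      apply: (integrableM_bounded (bdphit j)).
        exact: continuous_rV_measurable.
      exact: (square_integrable_brick (sv' j) (v'j_supp j)).
    by apply: eq_Rintegral => y _; rewrite dphiE mulrA.
  rewrite [X in _ * X](v'_div M _ C1t) mulrN mulN1r; congr (- _).
  rewrite -RintegralZl//; last first.
    apply: (integrableM_bounded bphit); first exact: continuous_rV_measurable.
    exact: (square_integrable_brick sm m_supp).
  by apply: eq_Rintegral => y _; rewrite mulrA.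
Qed.

End brick_divergence.

(** * Test functions *)

Section test_functions.
Context {R : realType} {d : nat}.
Implicit Types (phi : 'rV[R]_d -> R) (x : 'rV[R]_d).

Lemma partial_near_cst l phi x (c : R) :
  (\forall y \near x, phi y = c) -> partial l phi x = 0.
Proof.
move=> phic; rewrite /partial.
by rewrite (@near_eq_derive _ _ _ phi (cst c))// derive_cst.
Qed.

Lemma test_function_bounded_C1 (Om : set 'rV[R]_d) phi :
  test_function Om phi -> exists M, bounded_C1 M phi.
Proof.
move=> [sphi [Q [cQ _ phi0]]].
have oQ : open (~` Q).
  by apply: closed_openC; apply: compact_closed => //; exact: norm_hausdorff.
have bnd (f : 'rV[R]_d -> R) : continuous f -> (forall x, ~ Q x -> f x = 0) ->
    exists M, 0 <= M /\ forall x, `|f x| <= M.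
  move=> cf f0; have : compact (f @` Q).
    by apply: continuous_compact => //; exact: continuous_subspaceT.
  move=> /compact_bounded[M [_ Mf]]; exists (`|M| + 1); split; first by rewrite addr_ge0.
  move=> x; have [Qx|/f0 ->] := pselect (Q x); last by rewrite normr0 addr_ge0.
  apply: Mf; last by exists x.
  by rewrite (le_lt_trans (ler_norm _))// ltrDl.
have [cphi dphi] := sphi [::].
have cdphi l : continuous (partial l phi) by have [] := sphi [:: l].
have dphi0 l x : ~ Q x -> partial l phi x = 0.
  move=> nQx; apply: (@partial_near_cst _ _ _ 0).
  by apply: filterS (open_nbhs_nbhs (conj oQ nQx)) => y; exact: phi0.
have [M0 [M00 bphi]] := bnd phi cphi phi0.
have [M MP] := choice (fun l => bnd (partial l phi) (cdphi l) (dphi0 l)).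
exists (M0 + \sum_l M l); split => //.
- move=> x; apply: le_trans (bphi x) _; rewrite lerDl; apply: sumr_ge0 => l _.
  by have [] := MP l.
- move=> l x; have [Ml Mb] := MP l; apply: le_trans (Mb x) _.
  rewrite (bigD1 l)//= addrCA lerDl addr_ge0//; apply: sumr_ge0 => k _.
  by have [] := MP k.
Qed.

End test_functions.

(** * Integration over the elements of a mesh *)

Section mesh_integrals.
Context {R : realType}.

Lemma leb_hyperplane0 d (l : 'I_d) (c : R) : leb R d [set x | x 0 l = c] = 0%E.
Proof.
elim: d l => [|d ih] l; first by case: l.
rewrite leb_succE; case: (unliftP ord0 l) => [j ->|->].
  rewrite (_ : _ @^-1` _ = [set y : 'rV[R]_d | y 0 j = c] `*`
    [set: measurableTypeR R]); last first.
    by apply/seteqP; split => p /=; [rewrite rV_consS|rewrite rV_consS => -[]].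
  rewrite product_measure1E//; last first.
    rewrite (_ : mkset _ = coor j @^-1` [set c]); last by [].
    by rewrite -[X in measurable X]setTI; exact: measurable_coor.
  by rewrite [X in (X * _)%E](ih j) mul0e.
rewrite (_ : _ @^-1` _ = [set: 'rV[R]_d] `*`
    ([set c] : set (measurableTypeR R))); last first.
  by apply/seteqP; split => p /=; [rewrite rV_cons0|rewrite rV_cons0 => -[]].
rewrite product_measure1E//.
by rewrite [X in (_ * X)%E](lebesgue_measure_set1 c : _ = _) mule0.
Qed.

Context {d n : nat}.
Variables (Om : set 'rV[R]_d) (OmI : 'I_n -> set 'rV[R]_d).
Variables (sigma tau : R) (Th : 'I_n -> seq ('rV[R]_d * 'rV[R]_d)).
Hypotheses (mbOm : multiblock Om OmI) (mTh : mesh_of sigma tau OmI Th).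

Lemma measurable_multiblock : measurable Om.
Proof. by have [[oOm _ _] _ _ _] := mbOm; exact: open_rV_measurable. Qed.

Lemma obrick_multiblock i T : T \in Th i -> obrick T `<=` Om.
Proof.
move=> Ti; have [_ dI _ ->] := mbOm; have [oI _ _] := dI i.
apply: subset_trans (part_sub (mTh i) Ti) _.
rewrite -open_subsetE// => x Ox; exists i => //; exact: subset_closure.
Qed.

Lemma sum_obrick_indic i0 T0 x : T0 \in Th i0 -> obrick T0 x ->
  \sum_i \sum_(T <- Th i) \1_(obrick T) x = 1 :> R.
Proof.
move=> T0i0 T0x; have [_ _ dsj _] := mbOm.
rewrite (bigD1 i0)//= [X in _ + X]big1 => [|i ii0].
  rewrite addr0 (bigD1_seq T0)//=; last exact: part_uniq (mTh i0).
  rewrite indicE mem_set//= big_seq_cond big1 ?addr0// => T /andP[Ti0 TT0].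
  rewrite indicE memNset// => Tx.
  by have : (obrick T `&` obrick T0) x by []; rewrite (part_disj (mTh i0) Ti0 T0i0).
rewrite big_seq big1// => T Ti; rewrite indicE memNset// => Tx.
have : (OmI i `&` OmI i0) x.
  by split; [exact: (part_sub (mTh i) Ti)|exact: (part_sub (mTh i0) T0i0)].
by rewrite dsj.
Qed.

(** A point of the domain lies in some closed element, hence in an open one
    unless one of its coordinates is that of a corner of an element; this
    excludes finitely many hyperplanes. *)
Lemma ae_in_element :
  {ae leb R d, forall x, Om x -> exists i T, T \in Th i /\ obrick T x}.
Proof.
have ae_ne (l : 'I_d) (c : R) : {ae leb R d, forall x : 'rV[R]_d, x 0 l != c}.
  exists [set x : 'rV[R]_d | x 0 l = c]; split.
  - rewrite (_ : mkset _ = coor l @^-1` [set c]); last by [].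
    by rewrite -[X in measurable X]setTI; exact: measurable_coor.
  - exact: leb_hyperplane0.
  - by move=> x /= /negP; rewrite negbK => /eqP.
have ae_T (T : 'rV[R]_d * 'rV[R]_d) : {ae leb R d, forall x : 'rV[R]_d,
    forall l, x 0 l != T.1 0 l /\ x 0 l != T.2 0 l}.
  by apply: filter_forall => l; apply: filterI; exact: ae_ne.
have ae_s (s : seq ('rV[R]_d * 'rV[R]_d)) : {ae leb R d, forall x : 'rV[R]_d,
    forall T, T \in s -> forall l, x 0 l != T.1 0 l /\ x 0 l != T.2 0 l}.
  elim: s => [|T s ih]; first exact: aeW.
  apply: filterS2 (ae_T T) ih => x xT xs T'; rewrite inE => /predU1P[->//|].
  exact: xs.
have : {ae leb R d, forall x : 'rV[R]_d, forall i T, T \in Th i ->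
    forall l, x 0 l != T.1 0 l /\ x 0 l != T.2 0 l}.
  by apply: filter_forall => i; exact: ae_s.
apply: filterS => x xne Omx.
have [_ _ _ OmE] := mbOm.
have [i _ clx] : (\bigcup_i closure (OmI i)) x.
  by apply: interior_subset; rewrite -OmE.
move: clx; rewrite (part_cover (mTh i)) => -[T /= Ti Tx].
exists i, T; split => // l; have [n1 n2] := xne i T Ti l.
by have /andP[x1 x2] := Tx l; rewrite !lt_neqAle eq_sym n1 n2 x1 x2.
Qed.

Lemma mesh_Rintegral (F : 'rV[R]_d -> R) :
  (leb R d).-integrable Om (EFin \o F) ->
  \int[leb R d]_(x in Om) F x =
  \sum_i \sum_(T <- Th i) \int[leb R d]_(x in obrick T) F x.
Proof.
move=> iF; have mOm := measurable_multiblock.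
have iT T : (leb R d).-integrable Om (EFin \o (fun x => \1_(obrick T) x * F x)).
  apply: (le_integrable mOm _ _ iF).
    apply/measurable_EFinP; apply: measurable_funM.
      by apply: measurable_indic; exact: measurable_obrick.
    by apply/measurable_EFinP; exact: measurable_int iF.
  move=> x _; rewrite /= lee_fin normrM indicE.
  by case: (x \in _); rewrite ?normr1 ?mul1r// normr0 mul0r.
have is_ i : (leb R d).-integrable Om
    (EFin \o (fun x => \sum_(T <- Th i) \1_(obrick T) x * F x)).
  exact: integrable_sum_real.
transitivity (\int[leb R d]_(x in Om)
    (\sum_i \sum_(T <- Th i) \1_(obrick T) x * F x)).
  apply: ae_eq_Rintegral => //; first exact: integrable_sum_real.
  apply: filterS ae_in_element => x xT Omx.
  have [i [T [Ti Tx]]] := xT Omx.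
  under eq_bigr do rewrite -mulr_suml.
  by rewrite -mulr_suml (sum_obrick_indic Ti Tx) mul1r.
rewrite Rintegral_sum//; apply: eq_bigr => i _.
rewrite Rintegral_sum// [LHS]big_seq [RHS]big_seq; apply: eq_bigr => T Ti.
rewrite Rintegral_mkcond [RHS]Rintegral_mkcond; apply: eq_Rintegral => x _.
rewrite !patchE indicE; case: ifPn => xOm; case: ifPn => xT; rewrite ?mul1r ?mul0r//.
by move/negP: xOm; case; apply/mem_set/(obrick_multiblock Ti)/set_mem.
Qed.

End mesh_integrals.

(** * Dot product and bricks *)

Section brick_geometry.
Context {R : realType} {d : nat}.
Implicit Types (x y z : 'rV[R]_d) (T : 'rV[R]_d * 'rV[R]_d).

Lemma dotE x y : dot x y = \sum_l x 0 l * y 0 l.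
Proof. by rewrite /dot mxE; apply: eq_bigr => l _; rewrite mxE. Qed.

Lemma dotC x y : dot x y = dot y x.
Proof. by rewrite !dotE; apply: eq_bigr => l _; rewrite mulrC. Qed.

Lemma dotBl x y z : dot (x - y) z = dot x z - dot y z.
Proof. by rewrite /dot mulmxBl !mxE. Qed.

Lemma dotBr x y z : dot z (x - y) = dot z x - dot z y.
Proof. by rewrite dotC dotBl !(dotC z). Qed.

Lemma dotZl (c : R) x y : dot (c *: x) y = c * dot x y.
Proof. by rewrite /dot -scalemxAl mxE. Qed.

Lemma dotZr (c : R) x y : dot y (c *: x) = c * dot y x.
Proof. by rewrite dotC dotZl dotC. Qed.

Lemma dot_ge0 x : 0 <= dot x x.
Proof. by rewrite dotE; apply: sumr_ge0 => l _; rewrite -expr2 sqr_ge0. Qed.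

Lemma dot_eq0 x : dot x x <= 0 -> x = 0.
Proof.
move=> xx; have /eqP : dot x x = 0 by apply/eqP; rewrite eq_le xx dot_ge0.
rewrite dotE psumr_eq0; last by move=> l _; rewrite -expr2 sqr_ge0.
move=> /allP x0; apply/rowP => l; rewrite mxE; apply/eqP.
have := x0 l (mem_index_enum l); rewrite mulf_eq0 orbb.
by [].
Qed.

Lemma dot_young (c : R) x y : 0 < c ->
  dot x y <= c / 2 * dot x x + (2 * c)^-1 * dot y y.
Proof.
move=> c0; have := dot_ge0 (c *: x - y).
rewrite dotBl !dotBr !dotZl !dotZr (dotC y x) => H.
rewrite -(ler_pM2l (_ : 0 < 2 * c)); last by rewrite mulr_gt0.
rewrite mulrDr mulrA [X in _ + X]mulrA divff ?mul1r ?gt_eqF ?mulr_gt0//.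
by have -> : 2 * c * (c / 2) = c * c; [field|lra].
Qed.

Lemma edge_le_hT T l : (forall k, T.1 0 k < T.2 0 k) -> T.2 0 l - T.1 0 l <= hT T.
Proof.
move=> Tlt; rewrite /hT /diam.
have le_edge x y : cbrick T x -> cbrick T y ->
    enorm (x - y) <= Num.sqrt (\sum_k (T.2 0 k - T.1 0 k) ^+ 2).
  move=> Tx Ty; rewrite /enorm ler_sqrt; last first.
    by apply: sumr_ge0 => k _; exact: sqr_ge0.
  rewrite dotE; apply: ler_sum => k _; rewrite !mxE -expr2.
  have /andP[x1 x2] := Tx k; have /andP[y1 y2] := Ty k.
  by rewrite -subr_ge0 subr_sqr mulr_ge0//; lra.
have T1 : cbrick T T.1 by move=> k; rewrite lexx ltW.
have T2 : cbrick T T.2 by move=> k; rewrite lexx andbT ltW.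
apply: (@le_trans _ _ (enorm (T.2 - T.1))); last first.
  apply: ub_le_sup; last by exists T.2 => //; exists T.1.
  by exists (Num.sqrt (\sum_k (T.2 0 k - T.1 0 k) ^+ 2)) => _ [x Tx [y Ty <-]];
    exact: le_edge.
have -> : T.2 0 l - T.1 0 l = Num.sqrt ((T.2 0 l - T.1 0 l) ^+ 2).
  by rewrite sqrtr_sqr ger0_norm// subr_ge0 ltW.
rewrite /enorm ler_sqrt ?dot_ge0// dotE (bigD1 l)//= !mxE -expr2 lerDl.
by apply: sumr_ge0 => k _; rewrite !mxE -expr2 sqr_ge0.
Qed.

Lemma open_obrick T : open (obrick T).
Proof.
rewrite openE => x Tx; rewrite /interior.
suff : nbhs x [set y : 'rV[R]_d | forall l, T.1 0 l < y 0 l < T.2 0 l] by [].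
apply: (@filter_forall _ _ (fun l (y : 'rV[R]_d) => T.1 0 l < y 0 l < T.2 0 l)
  (nbhs x) (nbhs_filter x)) => l.
have cl := @coord_continuous R 1 d 0 l x.
have : nbhs (x 0 l) `]T.1 0 l, T.2 0 l[%classic.
  by apply: open_nbhs_nbhs; split; [exact: interval_open|rewrite /= in_itv; exact: Tx].
move=> /cl; apply: (@filterS _ (nbhs x) (nbhs_filter x)) => y /=.
by rewrite in_itv.
Qed.
End brick_geometry.

(** * The inverse tensor *)

Section inverse_tensor.
Context {R : realType} {d : nat}.
Variables (Om : set 'rV[R]_d) (K : 'rV[R]_d -> 'M[R]_d) (kmin kmax : R).
Hypotheses (mOm : measurable Om) (hK : spd_tensor Om K kmin kmax).

Let kmin0 : 0 < kmin. Proof. by have [/andP[]] := hK. Qed.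
Let kmax0 : 0 < kmax.
Proof. by have [/andP[k0 kk] _ _ _] := hK; exact: lt_trans kk. Qed.

Lemma tensor_unit x : Om x -> K x \in unitmx.
Proof.
move=> Omx; have [_ _ _ Kb] := hK.
rewrite -row_free_unit -kermx_eq0; apply/rowV0P => v /sub_kermxP vK.
apply: dot_eq0; rewrite -(pmulr_rle0 _ kmin0).
by have /andP[le _] := Kb x v Omx; move: le; rewrite vK mul0mx mxE.
Qed.

Lemma Kinv_mulmx (v : 'rV[R]_d -> 'rV[R]_d) x : Om x -> Kinv K v x *m K x = v x.
Proof.
move=> Omx; have [_ _ Ks _] := hK.
by rewrite /Kinv trmx_inv Ks// mulmxKV// tensor_unit.
Qed.

(** With [z] the value of [Kinv K v] at [x], the lower bound on [K] gives
    [kmin * |z|^2 <= z . v]; the claim then follows from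
    [0 <= |kmin z - v|^2]. *)
Lemma Kinv_sqr_le (v : 'rV[R]_d -> 'rV[R]_d) x : Om x ->
  dot (Kinv K v x) (Kinv K v x) <= (kmin ^+ 2)^-1 * dot (v x) (v x).
Proof.
move=> Omx; have [_ _ _ Kb] := hK.
have /andP[le _] := Kb x (Kinv K v x) Omx.
rewrite Kinv_mulmx// -/(dot _ _) (dotC (v x)) -(ler_pM2l kmin0) in le.
have := dot_ge0 (kmin *: Kinv K v x - v x).
rewrite dotBl !dotBr !dotZl !dotZr (dotC (v x) (Kinv K v x)) => H.
by rewrite ler_pdivlMl ?exprn_gt0// expr2 -mulrA; lra.
Qed.

(** With [z] as before, the quadratic form of [K] is nonnegative at
    [kmax z - v] and at most [kmax * |v|^2] at [v]; the cross terms are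
    [v . v] because [K] is symmetric. *)
Lemma Kinv_coercive (v : 'rV[R]_d -> 'rV[R]_d) x : Om x ->
  dot (v x) (v x) <= kmax * dot (Kinv K v x) (v x).
Proof.
move=> Omx; have [_ _ Ks Kb] := hK.
set z := Kinv K v x; have zK : z *m K x = v x by exact: Kinv_mulmx.
pose A := K x.
have sym (y w : 'rV[R]_d) : dot (y *m A) w = dot (w *m A) y.
  rewrite [RHS]dotC /dot trmx_mul /A Ks//.
  by rewrite mulmxA.
have /andP[k0 _] := Kb x (kmax *: z - v x) Omx.
have {k0} pos : 0 <= dot ((kmax *: z - v x) *m A) (kmax *: z - v x).
  apply: le_trans k0; apply: mulr_ge0; [exact: ltW|exact: dot_ge0].
have /andP[_ vv] := Kb x (v x) Omx.
rewrite -/(dot _ _) -/A in vv.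
rewrite mulmxBl -scalemxAl /A zK in pos.
rewrite dotBl !dotBr !dotZl !dotZr (sym (v x) z) /A zK in pos.
rewrite -(ler_pM2l kmax0) (dotC z).
by move: pos vv; rewrite /A; lra.
Qed.

Lemma measurable_det n (M : 'rV[R]_d -> 'M[R]_n) :
  (forall i j, measurable_fun Om (fun x => M x i j)) ->
  measurable_fun Om (fun x => \det (M x)).
Proof.
move=> mM; apply: measurable_sum => s; apply: measurable_funM => //.
by apply: measurable_prod => i _; exact: mM.
Qed.

Lemma measurable_inv (f : 'rV[R]_d -> R) : (forall x, Om x -> f x != 0) ->
  measurable_fun Om f -> measurable_fun Om (fun x => (f x)^-1).
Proof.
move=> f0 mf.
apply: (@measurable_comp _ _ _ _ _ _ (~` [set 0 : R]) (@GRing.inv R)) => //.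
- exact: measurableC.
- by move=> _ [x Omx <-] /= /eqP; apply/negP; exact: f0.
- apply: open_continuous_measurable_fun.
    by apply: closed_openC; exact: closed_eq.
  by move=> x; rewrite inE/= => /eqP x0; exact: inv_continuous.
Qed.

(** The entries of the inverse are rational functions of those of [K], by
    Cramer's formula. *)
Lemma measurable_Kinv (v : 'rV[R]_d -> 'rV[R]_d) l :
  (forall k, measurable_fun Om (fun x => v x 0 k)) ->
  measurable_fun Om (fun x => Kinv K v x 0 l).
Proof.
move=> mv; have [_ mK _ _] := hK.
pose f x := \sum_k v x 0 k * ((\det (K x))^-1 * cofactor (K x) k l).
apply: (@eq_measurable_fun _ _ _ _ _ f).
  move=> x /set_mem Omx; rewrite /Kinv mxE; apply: eq_bigr => k _.
  by rewrite mxE /invmx tensor_unit// !mxE.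
apply: measurable_sum => k; apply: measurable_funM; first exact: mv.
apply: measurable_funM.
  apply: measurable_inv; last exact: measurable_det.
  by move=> x /tensor_unit; rewrite unitmxE unitfE.
apply: measurable_funM => //; apply: measurable_det => i j.
under eq_fun do rewrite !mxE; exact: mK.
Qed.

Lemma L2v_Kinv (v : 'rV[R]_d -> 'rV[R]_d) : L2v Om v -> L2v Om (Kinv K v).
Proof.
move=> Lv l.
apply: (@le_square_integrable _ _ _ (leb R d) Om mOm _
  (fun x => (kmin ^+ 2)^-1 * \sum_k (v x 0 k ^+ 2))).
- by apply: measurable_Kinv => k; exact: (Lv k).1.
- apply: integrableZ_real => //; apply: integrable_sum_real => // k.
  exact: square_integrable_sqr (Lv k).
- move=> x Omx; apply: (@le_trans _ _ (dot (Kinv K v x) (Kinv K v x))).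
    rewrite dotE (bigD1 l)//= -expr2 lerDl; apply: sumr_ge0 => k _.
    by rewrite -expr2 sqr_ge0.
  apply: le_trans (Kinv_sqr_le v Omx) _; rewrite dotE.
  by under eq_bigr do rewrite -expr2.
Qed.

End inverse_tensor.

(** * Fields in L2 and H(div) *)

Section field_integrals.
Context {R : realType} {d : nat}.
Implicit Types (A : set 'rV[R]_d) (f g p : 'rV[R]_d -> R)
  (v w : 'rV[R]_d -> 'rV[R]_d).

Lemma norm2v_sqr A v : norm2v A v ^+ 2 = ipv A v v.
Proof. by rewrite sqr_sqrtr//; apply: Rintegral_ge0 => x _; exact: dot_ge0. Qed.

Lemma norm2_sqr A f : norm2 A f ^+ 2 = ip A f f.
Proof.
by rewrite sqr_sqrtr//; apply: Rintegral_ge0 => x _; rewrite -expr2 sqr_ge0.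
Qed.

Lemma integrable_dot A v w : measurable A -> L2v A v -> L2v A w ->
  (leb R d).-integrable A (EFin \o (fun x => dot (v x) (w x))).
Proof.
move=> mA Lv Lw; under eq_fun do rewrite dotE.
apply: integrable_sum_real => // l; exact: square_integrableM (Lv l) (Lw l).
Qed.

Lemma L2vB A v w : measurable A -> L2v A v -> L2v A w -> L2v A (v \- w).
Proof.
move=> mA Lv Lw l.
have E x : (v \- w) x 0 l = v x 0 l - w x 0 l by rewrite !mxE.
by rewrite (funext E); exact: square_integrableB (Lv l) (Lw l).
Qed.

Lemma L2vS A B v : measurable A -> measurable B -> B `<=` A ->
  L2v A v -> L2v B v.
Proof. by move=> mA mB BA Lv l; exact: square_integrableS BA (Lv l). Qed.

Lemma Rintegral_supp A B f : B `<=` A -> (forall x, ~ B x -> f x = 0) ->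
  \int[leb R d]_(x in A) f x = \int[leb R d]_(x in B) f x.
Proof.
move=> BA f0; rewrite Rintegral_mkcond [RHS]Rintegral_mkcond.
apply: eq_Rintegral => x _; rewrite !patchE.
case: ifPn => xA; case: ifPn => xB //.
  by rewrite f0// => Bx; move: xB; rewrite mem_set.
by move/negP: xA; case; apply/mem_set/BA/set_mem.
Qed.

Lemma le_ipv_young A v w (c : R) : measurable A -> 0 < c -> L2v A v -> L2v A w ->
  ipv A v w <= c / 2 * ipv A v v + (2 * c)^-1 * ipv A w w.
Proof.
move=> mA c0 Lv Lw.
have ivv := integrable_dot mA Lv Lv; have iww := integrable_dot mA Lw Lw.
rewrite /ipv -!RintegralZl// -RintegralD//; [|exact: integrableZ_real..].
apply: le_Rintegral => //; first exact: integrable_dot.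
  by apply: integrableD_real => //; exact: integrableZ_real.
by move=> x _; exact: dot_young.
Qed.

(** A field on an element whose divergence also holds against test functions
    that do not vanish on the boundary of the element extends by zero to a field
    in [H(div)] of the domain. *)
Lemma brick_hdiv (Om : set 'rV[R]_d) T g :
  measurable Om -> obrick T `<=` Om -> (forall l, T.1 0 l < T.2 0 l) ->
  L2 (obrick T) g -> \int[leb R d]_(x in obrick T) g x = 0 ->
  exists v, [/\ hdiv Om v (g \_ (obrick T)), forall x, ~ obrick T x -> v x = 0 &
    ipv (obrick T) v v <= 4 * d%:R * hT T ^+ 2 * ip (obrick T) g g].
Proof.
move=> mOm TOm Tlt Lg g_mean.
have mT := measurable_obrick T.
have sg : square_integrable (leb R d) setT (g \_ (obrick T)).
  exact: square_integrable_restrict Lg.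
have g0 x : ~ obrick T x -> (g \_ (obrick T)) x = 0.
  by move=> nTx; rewrite patchE memNset.
have [|v [sv v0 v_le v_div]] :=
    brick_divergence Tlt (fun l => edge_le_hT l Tlt) sg g0.
  by rewrite -Rintegral_mkcond.
have vOm : L2v Om v by move=> l; exact: square_integrableS (sv l).
have vl0 x l : ~ obrick T x -> v x 0 l = 0 by move=> /v0 ->; rewrite mxE.
have iv l := square_integrable_brick (sv l) (fun x => @vl0 x l).
exists v; split => //.
- split => //; first exact: square_integrableS sg.
  move=> phi tphi; have [M C1phi] := test_function_bounded_C1 tphi.
  have [cphi _ cdphi bphi bdphi] := C1phi.
  transitivity (\sum_l \int[leb R d]_x (v x 0 l * partial l phi x)).
    rewrite -(Rintegral_sum measurableT); last first.
      move=> l; apply: (integrableM_bounded (bdphi l)) (iv l).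
      exact: continuous_rV_measurable.
    rewrite /ipv -(@Rintegral_supp setT Om)//; last first.
      by move=> x nOmx; rewrite v0 ?dotE ?big1// => [l _|/TOm//]; rewrite mxE mul0r.
    apply: eq_Rintegral => x _; rewrite dotE; apply: eq_bigr => l _.
    by rewrite mxE.
  rewrite (v_div M phi C1phi); congr (- _); apply: Rintegral_supp => // x nOmx.
  by rewrite g0 ?mul0r// => /TOm.
- have -> : ip (obrick T) g g = \int[leb R d]_x ((g \_ (obrick T)) x ^+ 2).
    rewrite /ip Rintegral_mkcond; apply: eq_Rintegral => x _.
    by rewrite !patchE; case: ifP => _; rewrite ?expr2// mul0r.
  apply: le_trans v_le; rewrite -(Rintegral_sum measurableT); last first.
    by move=> l; exact: square_integrable_sqr.
  rewrite le_eqVlt; apply/orP; left; apply/eqP.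
  rewrite /ipv -(@Rintegral_supp setT)//; last first.
    by move=> x nTx; rewrite v0// dotE big1// => l _; rewrite mxE mul0r.
  apply: eq_Rintegral => x _; rewrite dotE.
  by apply: eq_bigr => l _; rewrite expr2.
Qed.

End field_integrals.

(** * The error estimate *)

Section error_estimate.
Context {R : realType} {d n : nat}.
Variables (Om : set 'rV[R]_d) (OmI : 'I_n -> set 'rV[R]_d).
Variables (K : 'rV[R]_d -> 'M[R]_d) (kmin kmax sigma tau : R).
Variable Th : 'I_n -> seq ('rV[R]_d * 'rV[R]_d).
Hypotheses (mbOm : multiblock Om OmI) (hK : spd_tensor Om K kmin kmax).
Hypothesis mTh : mesh_of sigma tau OmI Th.
Variables (f : 'rV[R]_d -> R) (u uh : 'rV[R]_d -> 'rV[R]_d).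
Variables (du duh p ph : 'rV[R]_d -> R).
Hypotheses (Lf : L2 Om f) (usol : exact_solution Om K f u du p).
Hypothesis uhsol : discrete_solution Om OmI Th K f uh duh ph.

Let mOm : measurable Om. Proof. exact: measurable_multiblock mbOm. Qed.
Let mT (T : 'rV[R]_d * 'rV[R]_d) : measurable (obrick T).
Proof. exact: measurable_obrick. Qed.
Let TOm i T : T \in Th i -> obrick T `<=` Om.
Proof. exact: obrick_multiblock mbOm mTh i T. Qed.
Let Lu : L2v Om u. Proof. by have [[]] := usol. Qed.
Let Lp : L2 Om p. Proof. by have [] := usol. Qed.
Let Luh : L2v Om uh. Proof. by have [_ []] := uhsol. Qed.
Let Lduh : L2 Om duh. Proof. by have [_ []] := uhsol. Qed.
Let Lg : L2 Om (f \- duh). Proof. exact: square_integrableB. Qed.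

Definition element_residual : R := \sum_i \sum_(T <- Th i)
  (ip (obrick T) (f \- duh) (f \- duh) * hT T ^+ 2).

Lemma grad_Wh0 i T x : T \in Th i -> obrick T x -> grad ph x = 0.
Proof.
move=> Ti Tx; have [_ _ [_ phc] _ _] := uhsol.
have [c phE] := phc i T Ti.
apply/rowP => l; rewrite !mxE; apply: (@partial_near_cst _ _ _ _ _ c).
apply: filterS (open_nbhs_nbhs (conj (@open_obrick _ _ T) Tx)) => y.
exact: phE.
Qed.

(** The discrete pressure is constant on each element, so the first term of the
    estimator is the norm of [Kinv K uh] itself. *)
Lemma estimator_ge :
  ipv Om (Kinv K uh) (Kinv K uh) + element_residual <=
  estimator Th K f uh duh ph.
Proof.
have LKuh : L2v Om (Kinv K uh) := L2v_Kinv mOm hK Luh.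
rewrite /estimator /ipv (mesh_Rintegral mbOm mTh); last exact: integrable_dot.
rewrite /element_residual -big_split/= -[X in X <= _]addr0; apply: lerD.
  apply: ler_sum => i _; rewrite -big_split/= [X in X <= _]big_seq [X in _ <= X]big_seq.
  apply: ler_sum => T Ti.
  rewrite norm2v_sqr norm2_sqr lerD2r /ipv le_eqVlt; apply/orP; left; apply/eqP.
  apply: eq_Rintegral => x /set_mem Tx.
  by rewrite /= (grad_Wh0 Ti Tx) addr0.
apply: sumr_ge0 => i _; apply: sumr_ge0 => j _; apply: sumr_ge0 => T _.
apply: sumr_ge0 => T' _; apply: sumr_ge0 => l _.
apply: divr_ge0.
  by apply: Rintegral_ge0 => y _; exact: sqr_ge0.
rewrite /diam; have [hs|/sup_out ->//] := pselect (has_sup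
  [set enorm (x - y) | x in cbrick (meet T T') & y in cbrick (meet T T')]).
have [z [x Tx [y Ty E]]] := hs.1.
apply: (@le_trans _ _ z); first by rewrite -E sqrtr_ge0.
by apply: sup_upper_bound => //; exists x => //; exists y.
Qed.

(** The indicator of an element belongs to [Wh], so the discrete mass balance
    holds on each element. *)
Lemma residual_mean0 i T : T \in Th i ->
  \int[leb R d]_(x in obrick T) (f \- duh) x = 0.
Proof.
move=> Ti; have [_ _ _ _ mass] := uhsol.
pose w := (\1_(obrick T) : 'rV[R]_d -> R).
have Lw : L2 Om w.
  apply: (square_integrableS measurableT) => //.
  exact: square_integrable_indic (mT T) (leb_obrick_lty T).
have [_ _ dsj _] := mbOm.
have Ww : Wh Om Th w.
  split => // j T' T'j; have [<-|TT'] := eqVneq T T'.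
    by exists 1 => x Tx; rewrite /w indicE mem_set.
  exists 0 => x T'x; rewrite /w indicE memNset// => Tx.
  have [ij|ij] := eqVneq i j.
    subst j.
    have : (obrick T `&` obrick T') x by [].
    by rewrite (part_disj (mTh i) Ti T'j).
  have : (OmI i `&` OmI j) x.
    by split; [exact: (part_sub (mTh i) Ti)|exact: (part_sub (mTh j) T'j)].
  by rewrite dsj.
have := mass w Ww => /eqP; rewrite eq_sym -subr_eq0 => /eqP E.
rewrite -[RHS]E /ip -RintegralB//; [|exact: square_integrableM..].
rewrite Rintegral_mkcond [RHS]Rintegral_mkcond; apply: eq_Rintegral => x _.
rewrite !patchE /w indicE; have [xT|xT] := boolP (x \in obrick T).
  by rewrite mem_set ?mulr1//; exact: TOm Ti _ (set_mem xT).
by case: ifP => _ //=; rewrite !mulr0 subr0.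
Qed.

(** The residual is the divergence of a field [v] supported in [T] whose norm
    is of order [hT T] times that of the residual; the first equation of the
    mixed problem turns the pairing of the residual with [p] into the pairing of
    [v] with [Kinv K u]. This takes the place of a Poincare inequality for [p]
    on [T]. *)
Lemma element_duality (c : R) i T : 0 < c -> T \in Th i ->
  \int[leb R d]_(x in obrick T) (p x * (f \- duh) x) <=
  c / 2 * ipv (obrick T) (Kinv K u) (Kinv K u) +
  (2 * c)^-1 * (4 * d%:R * (ip (obrick T) (f \- duh) (f \- duh) * hT T ^+ 2)).
Proof.
move=> c0 Ti; have [_ _ flux _] := usol.
have LgT : L2 (obrick T) (f \- duh).
  exact: square_integrableS (TOm Ti) Lg.
have [v [vdiv v0 v_le]] := brick_hdiv mOm (TOm Ti) (part_pos (mTh i) Ti) LgT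
  (residual_mean0 Ti).
have LKu : L2v Om (Kinv K u) := L2v_Kinv mOm hK Lu.
have Lv : L2v Om v by have [] := vdiv.
have -> : \int[leb R d]_(x in obrick T) (p x * (f \- duh) x) =
    ip Om p ((f \- duh) \_ (obrick T)).
  rewrite /ip [RHS](@Rintegral_supp _ _ _ (obrick T) _ (TOm Ti)).
    by apply: eq_Rintegral => x xT; rewrite patchE xT.
  by move=> x nTx; rewrite patchE memNset// mulr0.
have /eqP := flux v _ vdiv; rewrite subr_eq0 => /eqP <-.
have -> : ipv Om (Kinv K u) v = ipv (obrick T) (Kinv K u) v.
  apply: Rintegral_supp; first exact: TOm Ti.
  by move=> x nTx; rewrite v0// dotC dotE big1// => l _; rewrite mxE mul0r.
apply: le_trans (le_ipv_young (mT T) c0 _ _) _.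
- exact: L2vS (TOm Ti) LKu.
- exact: L2vS (TOm Ti) Lv.
rewrite lerD2l ler_wpM2l ?invr_ge0 ?mulr_ge0 ?(ltW c0)//.
by apply: le_trans v_le _; rewrite -[X in X <= _]mulrA [X in _ * X]mulrC.
Qed.

(** Testing the exact problem with [u] and with [uh] turns the left side into
    the pairing of [p] with [f \- duh]. *)
Lemma flux_residual_le (c : R) : 0 < c ->
  ipv Om (Kinv K u) (u \- uh) <=
  c / 2 * ipv Om (Kinv K u) (Kinv K u) + (2 * c)^-1 * (4 * d%:R * element_residual).
Proof.
move=> c0; have [hu _ flux divu] := usol.
have LKu : L2v Om (Kinv K u) := L2v_Kinv mOm hK Lu.
have [_ huh _ _ _] := uhsol.
have ipC q r : ip Om q r = ip Om r q.
  by apply: eq_Rintegral => x _; rewrite mulrC.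
have -> : ipv Om (Kinv K u) (u \- uh) = ip Om p (f \- duh).
  transitivity (ipv Om (Kinv K u) u - ipv Om (Kinv K u) uh).
    rewrite /ipv -RintegralB//; [|exact: integrable_dot..].
    by apply: eq_Rintegral => x _; rewrite /= dotBr.
  have /eqP := flux u _ hu; rewrite subr_eq0 => /eqP ->.
  have /eqP := flux uh _ huh; rewrite subr_eq0 => /eqP ->.
  rewrite (ipC p du) divu// (ipC f) /ip -RintegralB//;
    [|exact: square_integrableM..].
  by apply: eq_Rintegral => x _; rewrite /= mulrBr.
rewrite /ip (mesh_Rintegral mbOm mTh); last exact: square_integrableM Lp Lg.
rewrite {1}/ipv (mesh_Rintegral mbOm mTh); last exact: integrable_dot.
rewrite /element_residual !mulr_sumr -big_split/=; apply: ler_sum => i _.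
rewrite !mulr_sumr -big_split/= [X in X <= _]big_seq [X in _ <= X]big_seq.
by apply: ler_sum => T Ti; exact: element_duality c0 Ti.
Qed.

(** In the splitting of the energy of the error into the pairings of
    [Kinv K u] and of [- Kinv K uh] with it, Young's inequality is applied with
    the weights [c] and [2 * kmax]. They are chosen so that each pairing
    contributes a quarter of the squared error, after multiplication by
    [kmax]. *)
Lemma flux_error_le : norm2v Om (u \- uh) ^+ 2 <=
  (kmin ^+ 2 / 2 + 2 * kmax ^+ 2 + 16 * d%:R * kmax ^+ 2 / kmin ^+ 2) *
  estimator Th K f uh duh ph.
Proof.
have [/andP[kmin0 kminmax] _ _ _] := hK.
have kmax0 : 0 < kmax by exact: lt_trans kminmax.
set C := (X in X * _); pose e := u \- uh.
have Le : L2v Om e by exact: L2vB.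
have LKu := L2v_Kinv mOm hK Lu; have LKuh := L2v_Kinv mOm hK Luh.
have LKe := L2v_Kinv mOm hK Le.
have KeE x : Kinv K e x = Kinv K u x - Kinv K uh x by rewrite /Kinv mulmxBl.
rewrite norm2v_sqr -/e.
have C0 : 0 <= C.
  rewrite /C; apply: addr_ge0; last first.
    by rewrite mulr_ge0 ?invr_ge0 ?sqr_ge0// mulr_ge0 ?sqr_ge0.
  by apply: addr_ge0; rewrite mulr_ge0 ?sqr_ge0.
apply: le_trans (ler_wpM2l C0 estimator_ge).
set B := ipv Om (Kinv K uh) (Kinv K uh); set G := element_residual.
set A := ipv Om e e.
have A0 : 0 <= A by apply: Rintegral_ge0 => x _; exact: dot_ge0.
have B0 : 0 <= B by apply: Rintegral_ge0 => x _; exact: dot_ge0.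
have G0 : 0 <= G.
  apply: sumr_ge0 => i _; apply: sumr_ge0 => T _; rewrite mulr_ge0 ?sqr_ge0//.
  by apply: Rintegral_ge0 => x _; rewrite -expr2 sqr_ge0.
have coer : A <= kmax * ipv Om (Kinv K e) e.
  rewrite /A /ipv -RintegralZl//; last exact: integrable_dot.
  apply: le_Rintegral => //; [exact: integrable_dot| |].
    by apply: integrableZ_real => //; exact: integrable_dot.
  by move=> x Omx; exact: Kinv_coercive hK _ _ Omx.
have Ku_le : ipv Om (Kinv K u) (Kinv K u) <= 2 * (kmin ^+ 2)^-1 * A + 2 * B.
  have -> : 2 * (kmin ^+ 2)^-1 * A + 2 * B = \int[leb R d]_(x in Om)
      (2 * (kmin ^+ 2)^-1 * dot (e x) (e x) + 2 * dot (Kinv K uh x) (Kinv K uh x)).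
    by rewrite RintegralD ?RintegralZl//; try apply: integrableZ_real => //;
      exact: integrable_dot.
  apply: le_Rintegral => //; first exact: integrable_dot.
    by apply: integrableD_real => //; apply: integrableZ_real => //;
      exact: integrable_dot.
  move=> x Omx; have := Kinv_sqr_le hK e Omx; rewrite KeE.
  set y := Kinv K u x; set z := Kinv K uh x => le.
  have := dot_ge0 (y - z - z).
  move: le; rewrite !dotBl !dotBr (dotC z y); lra.
have split_e : ipv Om (Kinv K e) e = ipv Om (Kinv K u) e - ipv Om (Kinv K uh) e.
  rewrite /ipv -RintegralB//; [|exact: integrable_dot..].
  by apply: eq_Rintegral => x _; rewrite KeE dotBl.
pose c := kmin ^+ 2 / (4 * kmax).
have c0 : 0 < c by rewrite divr_gt0 ?exprn_gt0// mulr_gt0.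
have uh_le : - ipv Om (Kinv K uh) e <= kmax * B + (4 * kmax)^-1 * A.
  have LNuh : L2v Om (fun x => - Kinv K uh x).
    move=> l; have E x : (- Kinv K uh x) 0 l = -1 * Kinv K uh x 0 l.
      by rewrite mxE mulN1r.
    by rewrite (funext E); exact: square_integrableZ (LKuh l).
  have k2 : 0 < 2 * kmax by rewrite mulr_gt0.
  have := le_ipv_young mOm k2 LNuh Le.
  have -> : ipv Om (fun x => - Kinv K uh x) e = - ipv Om (Kinv K uh) e.
    rewrite -mulN1r /ipv -RintegralZl//; last exact: integrable_dot.
    by apply: eq_Rintegral => x _; rewrite -scaleN1r dotZl.
  have -> : ipv Om (fun x => - Kinv K uh x) (fun x => - Kinv K uh x) = B.
    apply: eq_Rintegral => x _; rewrite -scaleN1r dotZl dotZr.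
    by rewrite !mulN1r opprK.
  have -> : 2 * kmax / 2 = kmax by field.
  by have -> : 2 * (2 * kmax) = 4 * kmax by ring.
have res_le := flux_residual_le c0.
rewrite -/e -/G in res_le.
have key : A <= kmax * (c / 2 * (2 * (kmin ^+ 2)^-1 * A + 2 * B)
    + (2 * c)^-1 * (4 * d%:R * G) + (kmax * B + (4 * kmax)^-1 * A)).
  apply: le_trans coer _; rewrite ler_pM2l// split_e; apply: lerD => //.
  apply: le_trans res_le _; rewrite lerD2r ler_pM2l//.
  by rewrite divr_gt0.
have keyE : kmax * (c / 2 * (2 * (kmin ^+ 2)^-1 * A + 2 * B)
    + (2 * c)^-1 * (4 * d%:R * G) + (kmax * B + (4 * kmax)^-1 * A)) =
  A / 2 + (kmin ^+ 2 / 4 + kmax ^+ 2) * B + (8 * d%:R * kmax ^+ 2 / kmin ^+ 2) * G.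
  by rewrite /c; field; rewrite !gt_eqF.
rewrite keyE in key.
have k1 : 0 <= kmin ^+ 2 * G by rewrite mulr_ge0// sqr_ge0.
have k2 : 0 <= kmax ^+ 2 * G by rewrite mulr_ge0// sqr_ge0.
have k3 : 0 <= 16 * d%:R * kmax ^+ 2 / kmin ^+ 2 * B.
  by rewrite mulr_ge0// mulr_ge0 ?invr_ge0 ?sqr_ge0// mulr_ge0 ?sqr_ge0.
rewrite /C; lra.
Qed.

End error_estimate.

Unset Implicit Arguments.

Theorem theorem5 (R : realType) (d : nat) (hd : d = 2%N \/ d = 3%N)
  (n : nat) (Om : set 'rV[R]_d) (OmI : 'I_n -> set 'rV[R]_d)
  (hOm : multiblock Om OmI)
  (K : 'rV[R]_d -> 'M[R]_d) (kmin kmax : R) (hK : spd_tensor Om K kmin kmax)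
  (hreg : H2_regular Om K)
  (sigma tau alpha beta : R) (halpha : alpha < 1) (hbeta : beta < 1) :
  exists C : R,
    forall (Th : 'I_n -> seq ('rV[R]_d * 'rV[R]_d)), mesh_of sigma tau OmI Th ->
    forall (f : 'rV[R]_d -> R) (u uh : 'rV[R]_d -> 'rV[R]_d)
           (du duh p ph : 'rV[R]_d -> R),
      L2 Om f ->
      exact_solution Om K f u du p ->
      discrete_solution Om OmI Th K f uh duh ph ->
      saturation sigma tau alpha beta Om OmI K f u p Th uh ph ->
      norm2v Om (u \- uh) ^+ 2 <= C * estimator Th K f uh duh ph.
Proof.
exists (kmin ^+ 2 / 2 + 2 * kmax ^+ 2 + 16 * d%:R * kmax ^+ 2 / kmin ^+ 2).
move=> Th mTh f u uh du duh p ph Lf usol uhsol _.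
exact: (flux_error_le hOm hK mTh Lf usol uhsol).
Qed.
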